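(* For any $\varepsilon>0$ there is an $\varepsilon$-perturbative, stationary, mixing random environment $\omega=(\omega_u)_{u\in\mathbb Z^2}$ on $\mathbb Z^2$, with associated probability measure $P$, such that for the associated random walk $((X_t)_{t\in\mathbb N_0},P_0^\omega)$ it holds that $$P P_0^\omega\big(X_t\cdot\vec 1\xrightarrow[t\to\infty]{}\infty\big)>0\quad\text{as well as}\quad P P_0^\omega\big(X_t\cdot\vec 1\xrightarrow[t\to\infty]{}-\infty\big)>0 ,$$ where $\vec 1=(1,1)$.
   Context: Let $e_0=(1,0)$, $e_1=(0,1)$ and let $S^2$ be the set of all $\varpi\in[0,1]^{\{\pm e_0,\pm e_1\}}$ with $\sum_{e\in\{\pm e_0,\pm e_1\}}\varpi(e)=1$. A random environment on $\mathbb Z^2$ is a family $\omega=(\omega_u)_{u\in\mathbb Z^2}$ of $S^2$-valued random variables on a probability space $(\Omega,\mathcal A,P)$. The letter $P$ also denotes expectation with respect to $P$, so $PP_0^\omega(\cdot)$ is the $P$-expectation of $P_0^\omega(\cdot)$. Random walk: given $\omega$ and $v\in\mathbb Z^2$, $P_v^\omega$ is the law of the Markov chain $(X_t)_{t\in\mathbb N_0}$ on $\mathbb Z^2$ with $P_v^\omega(X_0=v)=1$ and $P_v^\omega(X_{t+1}=X_t+e\mid X_t=u)=\omega_u(e)$ for $u\in\mathbb Z^2$, $e\in\{\pm e_0,\pm e_1\}$. $\varepsilon$-perturbative: $P\big(\omega_u(e)\in[\tfrac14-\varepsilon,\tfrac14+\varepsilon]\big)=1$ for all $u\in\mathbb Z^2$,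 $e\in\{\pm e_0,\pm e_1\}$. Stationary: for every $v\in\mathbb Z^2$ the families $(\omega_{u+v})_{u\in\mathbb Z^2}$ and $(\omega_u)_{u\in\mathbb Z^2}$ have the same law. Mixing: the $\omega_u$ are discrete random variables and, for every $v\in\mathbb Z^2\setminus\{0\}$, every finite box $B\subseteq\mathbb Z^2$ (a product of two finite nonempty integer intervals) and all $f_1,f_2:B\to S^2$, $$\big|P(\omega|_B=f_1,\ \omega|_{B+nv}=\theta_{nv}f_2)-P(\omega|_B=f_1)\,P(\omega|_{B+nv}=\theta_{nv}f_2)\big|\xrightarrow[n\to\infty]{}0,$$ where $B+w=\{u+w:u\in B\}$ and $(\theta_wf)_u=f_{u-w}$ for $u\in B+w$. *)

(* Defs.v *)
From HB Require Import structures.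
From mathcomp Require Import all_boot all_order all_algebra.
From mathcomp Require Import all_classical all_reals all_analysis.

Set Implicit Arguments.
Unset Strict Implicit.
Unset Printing Implicit Defensive.

Import Order.TTheory GRing.Theory Num.Theory.
Import numFieldNormedType.Exports.

Local Open Scope classical_set_scope.
Local Open Scope ring_scope.

Definition Z2 : Type := (int * int)%type.
HB.instance Definition _ := GRing.Zmodule.on Z2.
HB.instance Definition _ := isPointed.Build Z2 0.
HB.instance Definition _ := @isMeasurable.Build default_measure_display
  Z2 discrete_measurable discrete_measurable0
  discrete_measurableC discrete_measurableU.

Definition e0 : Z2 := (1, 0).
Definition e1 : Z2 := (0, 1).
Definition ones : Z2 := (1, 1).

Definition dotZ2 (x y : Z2) : int := x.1 * y.1 + x.2 * y.2.

Definition dir : Type := seq_sub [:: e0; - e0; e1; - e1].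
HB.instance Definition _ := Finite.on dir.
HB.instance Definition _ := SubType.on dir.

Definition is_simplex (R : realType) (w : {ffun dir -> R}) : bool :=
  [forall e, 0 <= w e <= 1] && (\sum_e w e == 1).

Record S2 (R : realType) : Type :=
  MkS2 { weight :> {ffun dir -> R}; weightP : is_simplex weight }.
HB.instance Definition _ (R : realType) := [isSub for @weight R].
HB.instance Definition _ (R : realType) := [Choice of S2 R by <:].

Lemma card_dir : #|{: dir}| = 4%N.
Proof. by rewrite card_seq_sub. Qed.

Lemma is_simplex_uniform (R : realType) :
  is_simplex [ffun _ : dir => (4%:R^-1 : R)].
Proof.
apply/andP; split.
  apply/forallP => e; rewrite ffunE invr_ge0 ler0n /=.
  by rewrite invf_le1 ?ler1n // ltr0n.
under eq_bigr do rewrite ffunE.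
by rewrite sumr_const card_dir -[X in X == _]mulr_natr mulVf // pnatr_eq0.
Qed.

HB.instance Definition _ (R : realType) :=
  isPointed.Build (S2 R) (MkS2 (is_simplex_uniform R)).

(* The trace on S2 of the Borel sigma-algebra of R^4, i.e. the smallest
   sigma-algebra making the four weights measurable. *)
Definition S2_generators (R : realType) : set_system (S2 R) :=
  \bigcup_(e : dir)
    preimage_set_system setT (fun w : S2 R => w e) measurable.

HB.instance Definition _ (R : realType) :=
  @isMeasurable.Build (sigma_display (@S2_generators R)) (S2 R)
    <<s @S2_generators R >> (@sigma_algebra0 _ setT (@S2_generators R))
    (@sigma_algebraC _ (@S2_generators R))
    (@sigma_algebra_bigcup _ setT (@S2_generators R)).

Definition cylinders (I : Type) (d : measure_display) (T : measurableType d) :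
    set_system (I -> T) :=
  \bigcup_(i : I) preimage_set_system setT (fun x : I -> T => x i) measurable.

Definition product_space (I : Type) (d : measure_display)
  (T : measurableType d) := g_sigma_algebraType (@cylinders I d T).

Definition env_space (R : realType) := product_space Z2 (S2 R).
Definition path_space := product_space nat Z2.
HB.instance Definition _ (R : realType) := Measurable.on (env_space R).
HB.instance Definition _ := Measurable.on path_space.

Definition perturbative (R : realType) (d : measure_display)
    (Omega : measurableType d) (P : probability Omega R)
    (omega : Z2 -> {RV P >-> S2 R}) (eps : R) : Prop :=
  forall (u : Z2) (e : dir),
    P [set x | omega u x e \in `[4%:R^-1 - eps, 4%:R^-1 + eps]] = 1%E.

Definition stationary (R : realType) (d : measure_display)
    (Omega : measurableType d) (P : probability Omega R)
    (omega : Z2 -> {RV P >-> S2 R}) : Prop :=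
  forall (v : Z2) (A : set (env_space R)), measurable A ->
    pushforward P (fun x => (fun u => omega (u + v) x) : env_space R) A =
    pushforward P (fun x => (fun u => omega u x) : env_space R) A.

Definition box (a b : Z2) : set Z2 :=
  [set` `[a.1, b.1]] `*` [set` `[a.2, b.2]].

Definition translate (B : set Z2) (w : Z2) : set Z2 := [set u + w | u in B].

(* A function B -> S2 is represented by any of its extensions Z2 -> S2; only
   the values on B are ever used. *)
Definition theta (R : realType) (w : Z2) (f : Z2 -> S2 R) : Z2 -> S2 R :=
  fun u => f (u - w).

Definition agrees (R : realType) (d : measure_display)
    (Omega : measurableType d) (P : probability Omega R)
    (omega : Z2 -> {RV P >-> S2 R}) (B : set Z2) (f : Z2 -> S2 R) :
    set Omega :=
  [set x | forall u, B u -> omega u x = f u].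

(* Discreteness of each omega u is countability of its range, as in the
   library's [{dRV P >-> T}]. *)
Definition mixing (R : realType) (d : measure_display)
    (Omega : measurableType d) (P : probability Omega R)
    (omega : Z2 -> {RV P >-> S2 R}) : Prop :=
  (forall u : Z2, countable (range (omega u))) /\
  forall v a b : Z2, v != 0 -> a.1 <= b.1 -> a.2 <= b.2 ->
  forall f1 f2 : Z2 -> S2 R,
    let E1 := agrees omega (box a b) f1 in
    let E2 n :=
      agrees omega (translate (box a b) (v *+ n)) (theta (v *+ n) f2) in
    (`| P (E1 `&` E2 n) - P E1 * P (E2 n) |)%E @[n --> \oo] --> 0%E.

(* [mu] is the law of the Markov chain started at [v] which jumps from [u] to
   [u + e] with probability [w u e]; the second clause is the transition rule
   conditional on the whole history, multiplied by the probability of the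
   history. *)
Definition walk_law (R : realType) (w : Z2 -> S2 R) (v : Z2)
    (mu : {measure set path_space -> \bar R}) : Prop :=
  mu [set X | X 0%N = v] = 1%E /\
  forall (p : nat -> Z2) (t : nat) (e : dir),
    mu [set X | (forall s, (s <= t)%N -> X s = p s) /\
                X t.+1 = p t + val e] =
    (mu [set X | forall s, (s <= t)%N -> X s = p s] * (w (p t) e)%:E)%E.

(* [Q x] is the quenched law P_0^omega at the sample point [x]. Such a kernel
   is unique, since [walk_law] determines the measure on all cylinders. *)
Definition quenched_law (R : realType) (d : measure_display)
    (Omega : measurableType d) (P : probability Omega R)
    (omega : Z2 -> {RV P >-> S2 R}) (Q : R.-pker Omega ~> path_space) : Prop :=
  forall x : Omega, walk_law (fun u => omega u x) 0 (Q x).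

(* P P_0^omega *)
Definition annealed (R : realType) (d : measure_display)
    (Omega : measurableType d) (P : probability Omega R)
    (Q : R.-pker Omega ~> path_space) (A : set path_space) : \bar R :=
  (\int[P]_x Q x A)%E.

Definition to_pinfty (R : realType) : set path_space :=
  [set X | ((dotZ2 (X t) ones)%:~R : R) @[t --> \oo] --> +oo].

Definition to_ninfty (R : realType) : set path_space :=
  [set X | ((dotZ2 (X t) ones)%:~R : R) @[t --> \oo] --> -oo].

(* Main.v *)
Require Import Defs.
From HB Require Import structures.
From mathcomp Require Import all_boot all_order all_algebra.
From mathcomp Require Import all_classical all_reals all_analysis.
From mathcomp Require Import measurable_realfun.
From mathcomp Require Import zify ring lra.

(** The environment is a map of one-way roads, built from independent marks at
    infinitely many scales. A mark of level [k] lays out a pair of long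
    parallel roads, horizontal for even [k] and vertical for odd [k]. On one
    road of the pair the local drift points up or right, along the axis, and
    also towards the center line; the other road is its image under a point
    reflection. Where roads cross, the higher level wins. The order of the
    roads within a pair is such that a walk on an increasing road of level [k]
    runs into the increasing road of the first pair of level [k+1] that it
    meets, and a walk on a decreasing road into the decreasing one. The
    increasing roads thus form one tree and the decreasing ones another; the
    branches of the two trees fit between each other, and one tree leads to
    infinity in the direction (1,1), the other in the direction (-1,-1).

    As the drift is small, a walk may diffuse off its road. On a road of
    half-width [w] this happens along a distance [L] with probability of order
    [L] times an exponentially small function of [w]. The half-widths grow
    faster than the logarithms of the distances travelled, so that the total
    risk of ever leaving the chain of roads is at most 1/2. This is shown with
    a function [risk], an infimum of explicit local supersolutions, which is
    superharmonic for the walk ([risk_super]), is at most 1/2 at the start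
    ([risk_center]), and is equal to 1 off the roads. On the roads the drift
    in the direction (1,1) is bounded below, so a walk that never leaves them
    escapes to infinity ([escape], [road_escape]).

    The layout around the origin is the expected one at level [k] up to a
    probability of order [2 ^ (- rank k)] ([pr_bad]): the roads of level [k]
    are at a typical distance a bit above [radius k] from each other, so none
    of them comes within [radius k], some come within [radius (k+1)] and no
    two of them are close to each other there; and they are so long that they
    do not end within [radius (k+2)]. The levels are independent, hence with
    positive probability the origin lies on the center of a road of level 0
    and every higher level is as expected ([good_set]). In this case the
    origin is the start of an infinite chain of roads ([good_road]). The point
    reflection exchanges the two directions and preserves the law of the marks.

    Finally, the environment is a translation-equivariant function of
    independent fair coins. It is therefore stationary, and it is mixing since
    events of the coins are approximated by events that look at finitely many
    coins ([fair_mixing]). The quenched law is the image of the law of further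
    fair coins under a map that is jointly measurable in the environment and
    these coins, which makes it a kernel ([walk_kernel]). *)

Set Implicit Arguments.
Unset Strict Implicit.
Unset Printing Implicit Defensive.

Import Order.TTheory GRing.Theory Num.Theory.
Import numFieldNormedType.Exports.

Local Open Scope classical_set_scope.
Local Open Scope ring_scope.

(** * Fair coins *)

Definition coins (I : Type) := product_space I bool.
HB.instance Definition _ (I : Type) := Measurable.on (coins I).

Definition fair (I : eqType) (R : realType) (P : probability (coins I) R) : Prop :=
  forall s : seq I, uniq s ->
    P [set y : coins I | {in s, forall i, y i}] = ((2^-1) ^+ size s)%:E.

Lemma measurable_coin (I : Type) (i : I) : measurable [set y : coins I | y i].
Proof.
apply: sub_sigma_algebra; exists i => //; exists [set b : bool | b] => //.
by rewrite setTI.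
Qed.

Lemma measurable_to_product (I : Type) d (T : measurableType d) d'
    (X : measurableType d') (f : X -> product_space I T) :
  (forall i, measurable_fun setT (fun x => f x i)) -> measurable_fun setT f.
Proof.
move=> mf; apply: (@measurability _ _ X (product_space I T) setT f
  (@cylinders I d T)) => //.
move=> _ [_ [i _ [B mB <-]] <-]; rewrite !setTI.
by rewrite -[X in measurable X]setTI; exact: mf.
Qed.

Lemma measurable_proj (I : Type) d (T : measurableType d) (i : I) :
  measurable_fun setT (fun y : product_space I T => y i).
Proof.
move=> _ B mB; apply: sub_sigma_algebra; exists i => //; exists B => //.
Qed.

Lemma measurable_reindex (I J : Type) d (T : measurableType d) (f : J -> I) :
  measurable_fun setT
    ((fun y => y \o f) : product_space I T -> product_space J T).
Proof. by apply: measurable_to_product => j; exact: measurable_proj. Qed.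

Lemma probability_setU d (T : measurableType d) (R : realType)
    (P : probability T R) (A B : set T) :
  measurable A -> measurable B -> A `&` B = set0 ->
  P (A `|` B) = (P A + P B)%E.
Proof. exact: measureU. Qed.

Section binary_digits.
Variable R : realType.

Definition digit (n : nat) (x : R) : bool := odd (Num.truncn (2 ^+ n.+1 * x)).

Fixpoint dyadic (s : nat -> bool) (n : nat) : nat :=
  if n is n'.+1 then ((dyadic s n').*2 + s n')%N else 0%N.

Lemma truncn_half (x : R) : 0 <= x -> (Num.truncn (2 * x))./2 = Num.truncn x.
Proof.
move=> x0; apply/esym/eqP; rewrite truncn_eq //.
have /andP[] := truncn_itv (mulr_ge0 (ler0n R 2) x0).
set N := Num.truncn _ => h1 h2.
have hN := odd_double_half N; rewrite -hN in h1 h2; move: h1 h2.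
rewrite -muln2 -!natr1 !natrD !natrM.
case: (odd N) => /= h1 h2; apply/andP; split; lra.
Qed.

Lemma digits_dyadic (s : nat -> bool) n (x : R) : 0 <= x < 1 ->
  (forall i, (i < n)%N -> digit i x = s i) <->
  Num.truncn (2 ^+ n * x) = dyadic s n.
Proof.
move=> /andP[x0 x1]; elim: n => [|n IH].
  split => // _; rewrite expr0 mul1r.
  by apply/eqP; rewrite truncn_eq // x0.
have h : (Num.truncn (2 ^+ n.+1 * x))./2 = Num.truncn (2 ^+ n * x).
  by rewrite exprS -mulrA truncn_half // mulr_ge0 // exprn_ge0.
split=> [H|H] /=.
  rewrite -(odd_double_half (Num.truncn _)) h addnC; congr (_.*2 + _)%N.
    by apply/IH => i lin; apply: H; rewrite ltnW.
  by congr nat_of_bool; exact: H.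
have Hn : digit n x = s n.
  by rewrite /digit H /= oddD odd_double /=; case: (s n).
move=> i; rewrite ltnS leq_eqVlt => /orP[/eqP->//|lin].
apply: (IH.2 _ i lin); rewrite -h H /=.
by rewrite halfD odd_double /= add0n doubleK; case: (s n); rewrite ?addn0.
Qed.

Lemma dyadic_lt (s : nat -> bool) n : (dyadic s n < 2 ^ n)%N.
Proof.
elim: n => [|n IH] //=; rewrite expnS; case: (s n); lia.
Qed.

Lemma measurable_digit n : measurable_fun setT (digit n : measurableTypeR R -> bool).
Proof.
apply: (@measurable_fun_bool _ _ _ _ true); rewrite setTI.
rewrite (_ : _ @^-1` _ =
    \bigcup_(N in [set N : nat | odd N])
      [set` `[(N%:R / 2 ^+ n.+1 : R), N.+1%:R / 2 ^+ n.+1[]).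
  by apply: bigcup_measurable => N _; exact: measurable_itv.
have c0 : (0 : R) < 2 ^+ n.+1 by rewrite exprn_gt0.
apply/seteqP; split=> [x /= dx|x [N /= oN]].
  exists (Num.truncn (2 ^+ n.+1 * x)) => //=.
  have x0 : 0 <= 2 ^+ n.+1 * x.
    rewrite leNgt; apply/negP => x0; move: dx; rewrite /digit.
    by rewrite truncn_floor leNgt x0.
  rewrite in_itv /= ler_pdivrMr // ltr_pdivlMr // ![x * _]mulrC.
  exact: truncn_itv.
rewrite in_itv /= ler_pdivrMr // ltr_pdivlMr // ![x * _]mulrC => h.
by rewrite /digit (truncn_def h).
Qed.

Definition digits (x : R) : coins nat := digit ^~ x.

Lemma measurable_digits : measurable_fun setT (digits : measurableTypeR R -> coins nat).
Proof. by apply: measurable_to_product => n; exact: measurable_digit. Qed.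

(** The interval is half-open because the point 1 has the same digits as 0. *)
Definition unit_uniform := mrestr (@lebesgue_measure R) (measurable_itv `[0 : R, 1[).

HB.instance Definition _ := Measure.on unit_uniform.

Let unit_uniformT : unit_uniform setT = 1%E.
Proof.
by rewrite /unit_uniform /mrestr setTI lebesgue_measure_itv /= lte_fin ltr01 sube0.
Qed.

HB.instance Definition _ :=
  @Measure_isProbability.Build _ _ R unit_uniform unit_uniformT.

Lemma prob_digits (s : nat -> bool) n :
  unit_uniform [set x | forall i, (i < n)%N -> digit i x = s i] =
  (2^-1 ^+ n)%:E.
Proof.
pose a : R := (dyadic s n)%:R / 2 ^+ n.
pose b : R := (dyadic s n).+1%:R / 2 ^+ n.
have c0 : (0 : R) < 2 ^+ n by rewrite exprn_gt0.
have ab : a < b by rewrite ltr_pM2r ?invr_gt0 // ltr_nat.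
have a0 : 0 <= a by rewrite divr_ge0 // ltW.
have b1 : b <= 1.
  by rewrite ler_pdivrMr // mul1r -natrX ler_nat dyadic_lt.
rewrite /unit_uniform /mrestr (_ : _ `&` _ = `[a, b[%classic); last first.
  have trE (x : R) : 0 <= x -> (Num.truncn (2 ^+ n * x) == dyadic s n) =
      (a <= x < b).
    move=> x0; rewrite truncn_eq ?mulr_ge0 ?(ltW c0) //.
    by rewrite ler_pdivrMr // ltr_pdivlMr // ![x * _]mulrC.
  apply/seteqP; split=> x /=; rewrite !in_itv /=.
    move=> [dx /[dup] x01 /andP[x0 x1]]; rewrite -trE //; apply/eqP.
    exact/digits_dyadic.
  move=> abx; have /andP[ax xb] := abx.
  have x0 : 0 <= x := le_trans a0 ax.
  have x01 : 0 <= x < 1 by rewrite x0 (lt_le_trans xb b1).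
  by split=> //; apply/digits_dyadic => //; apply/eqP; rewrite trE.
rewrite lebesgue_measure_itv /= lte_fin ab.
by rewrite -EFinB -mulrBl -natrB // subSnn mul1r exprVn.
Qed.

End binary_digits.

Lemma measurable_cylinder (I : eqType) (s : seq I) (v : I -> bool) :
  measurable [set y : coins I | {in s, forall i, y i = v i}].
Proof.
elim: s => [|j s IH].
  rewrite (_ : [set _ | _] = setT); first exact: measurableT.
  by apply/seteqP; split.
rewrite (_ : [set _ | _] = [set y : coins I | y j = v j] `&`
   [set y | {in s, forall i, y i = v i}]); last first.
  apply/seteqP; split=> y /=.
    by move=> H; split=> [|i si]; apply: H; rewrite inE ?eqxx ?si ?orbT.
  by move=> [H1 H2] i; rewrite inE => /orP[/eqP->|/H2].
apply: measurableI => //; case: (v j); first exact: (measurable_coin j).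
rewrite (_ : [set _ | _] = ~` [set y : coins I | y j]).
  by apply: measurableC; exact: (measurable_coin j).
by apply/seteqP; split=> y /=; case: (y j).
Qed.

(** The constraints on the coins of [s] are relaxed one at a time, starting
    from the full list of the first [n] coins. *)
Lemma fair_of_prefixes (R : realType) (P : probability (coins nat) R) :
  (forall n (v : nat -> bool),
    P [set y : coins nat | forall i, (i < n)%N -> y i = v i] = (2^-1 ^+ n)%:E) ->
  fair P.
Proof.
move=> prefP.
suff cyl n k (s : seq nat) (v : nat -> bool) : uniq s -> {in s, forall i, (i < n)%N} ->
    (size s + k = n)%N ->
    P [set y : coins nat | {in s, forall i, y i = v i}] = ((2^-1) ^+ size s)%:E.
  move=> s us; pose n := (\max_(i <- s) i).+1.
  have ss : {in s, forall i, (i < n)%N}.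
    by move=> i si; rewrite ltnS; exact: leq_bigmax_seq.
  have sn : (size s <= n)%N.
    rewrite -(size_iota 0 n); apply: uniq_leq_size => // i /ss.
    by rewrite mem_iota add0n.
  exact: (cyl n (n - size s)%N s (fun=> true) us ss (subnKC sn)).
elim: k s v => [|k IH] s v us sn.
  rewrite addn0 => szs; rewrite szs -(prefP n v).
  congr (P _); apply/seteqP; split=> x /= H i.
    move=> lin; apply: H.
    have sub : {subset s <= iota 0 n}.
      by move=> j /sn; rewrite mem_iota add0n.
    have szi : (size (iota 0 n) <= size s)%N by rewrite size_iota szs.
    by rewrite (uniq_min_size us sub szi) mem_iota.
  by move=> /sn; exact: H.
move=> szs.
have [i [ilt ni]] : exists i, (i < n)%N /\ i \notin s.
  apply: contrapT => /forallNP H.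
  have : (size (iota 0 n) <= size s)%N.
    apply: uniq_leq_size (iota_uniq _ _) _ => i; rewrite mem_iota add0n => ilt.
    by have /not_andP[//|/negP] := H i; rewrite negbK.
  by rewrite size_iota; lia.
pose w b j := if j == i then b else v j.
rewrite (_ : [set _ | _] =
    [set y : coins nat | {in i :: s, forall j, y j = w true j}] `|`
    [set y : coins nat | {in i :: s, forall j, y j = w false j}]); last first.
  apply/seteqP; split=> y /=.
    move=> H; case yi: (y i); [left|right] => j; rewrite inE /w;
      by case: (eqVneq j i) => [->|_] //= /H.
  have wv b j : j \in s -> w b j = v j.
    by rewrite /w; case: eqP => // -> sj; rewrite sj in ni.
  by case=> H j sj; rewrite H ?inE ?sj ?orbT //; exact: wv.
have us' : uniq (i :: s) by rewrite /= ni.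
have sn' : {in i :: s, forall j, (j < n)%N}.
  by move=> j; rewrite inE => /orP[/eqP->|/sn].
have E b : P [set y : coins nat | {in i :: s, forall j, y j = w b j}] =
    ((2^-1) ^+ (size s).+1)%:E.
  by apply: IH => //=; rewrite addSn -addnS.
rewrite probability_setU; [|exact: measurable_cylinder..|].
  by rewrite !E -EFinD /= exprS; congr (_%:E); lra.
apply/seteqP; split=> // y [] /=.
move=> /(_ i (mem_head _ _)) + /(_ i (mem_head _ _)).
by rewrite /w eqxx => ->.
Qed.

Lemma fair_coins_nat (R : realType) :
  exists P : probability (coins nat) R, fair P.
Proof.
have mD := measurable_digits (R := R).
pose X : {mfun measurableTypeR R >-> coins nat} :=
  @mfun_Sub _ _ (measurableTypeR R) (coins nat) (@digits R) (mem_set mD).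
exists (distribution (@unit_uniform R) X).
apply: fair_of_prefixes => n v; exact: prob_digits.
Qed.

(** The events that all coins of [s] show heads, for finite [s], form a
    generating pi-system. *)
Lemma coins_measure_unique (I : eqType) (R : realType)
    (m1 m2 : {measure set (coins I) -> \bar R}) :
  (forall s : seq I, uniq s -> m1 [set y : coins I | {in s, forall i, y i}] =
                    m2 [set y : coins I | {in s, forall i, y i}]) ->
  (m1 setT < +oo)%E ->
  forall A, measurable A -> m1 A = m2 A.
Proof.
move=> m12 m1T.
pose up (s : seq I) := [set y : coins I | {in s, forall i, y i}].
pose G : set (set (coins I)) := range up.
have upT : up [::] = setT by apply/seteqP; split.
apply: (@measure_unique _ R _ G (fun=> setT)) => //.
- apply/seteqP; split; last first.
    apply: smallest_sub; first exact: sigma_algebra_measurable.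
    by move=> _ [s _ <-]; exact: (measurable_cylinder s (fun=> true)).
  apply: smallest_sub; first exact: smallest_sigma_algebra.
  move=> _ [i _ [B _ <-]].
  have mi : measurable_fun setT (fun y : g_sigma_algebraType G => y i).
    apply: (@measurable_fun_bool _ _ _ _ true); rewrite setTI.
    apply: sub_sigma_algebra; exists [:: i] => //.
    apply/seteqP; split=> y /=; first by apply; rewrite inE.
    by move=> yi j; rewrite inE => /eqP ->.
  exact: (mi measurableT B).
- move=> _ _ [s _ <-] [t _ <-]; exists (s ++ t) => //.
  apply/seteqP; split=> y /=.
    by move=> H; split=> i si; apply: H; rewrite mem_cat si ?orbT.
  by move=> [H1 H2] i; rewrite mem_cat => /orP[/H1|/H2].
- by move=> _; exists [::].
- by rewrite bigcup_const.
- move=> _ [s _ <-].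
  have -> : up s = up (undup s).
    by apply/seteqP; split=> y H i si; apply: H; rewrite mem_undup in si *.
  exact/m12/undup_uniq.
Qed.

Definition determined (I T : Type) (D : set I) (f : coins I -> T) : Prop :=
  forall x y : coins I, (forall i, D i -> x i = y i) -> f x = f y.

(** A finitely determined map takes each value on a finite union of
    cylinders: the coins of [s] are revealed one after the other. *)
Lemma measurable_determined (I : eqType) (T : Type) (s : seq I)
    (f : coins I -> T) (B : set T) :
  determined [set` s] f -> measurable (f @^-1` B).
Proof.
elim: s f => [|i s IH] f fs.
  have fc x : f x = f (fun=> true) by apply: fs.
  have [Bt|nBt] := pselect (B (f (fun=> true))).
    rewrite (_ : _ @^-1` _ = setT); first exact: measurableT.
    by apply/seteqP; split=> x //= _; rewrite fc.
  rewrite (_ : _ @^-1` _ = set0); first exact: measurable0.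
  by apply/seteqP; split=> x //=; rewrite fc.
pose g b (y : coins I) : coins I := fun j => if j == i then b else y j.
have gs b : determined [set` s] (f \o g b).
  move=> x y xy; apply: fs => j /=; rewrite inE /g.
  by case: eqP => //= _ sj; apply: xy.
have gy y : g (y i) y = y by apply/funext => j; rewrite /g; case: eqP => [->|].
rewrite (_ : f @^-1` B =
    ([set y : coins I | y i] `&` (f \o g true) @^-1` B) `|`
    (~` [set y : coins I | y i] `&` (f \o g false) @^-1` B)).
  apply: measurableU; apply: measurableI; [|exact: IH| |exact: IH].
    exact: (measurable_coin i).
  by apply: measurableC; exact: (measurable_coin i).
apply/seteqP; split=> y /=; have := gy y.
  by case: (y i) => yi By; [left|right]; rewrite yi.
by move=> yi []; case E: (y i) yi => yi [] // _; rewrite yi.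
Qed.

Section fair_theory.
Variables (I : eqType) (R : realType) (P : probability (coins I) R).

Let PToo : (P setT < +oo)%E.
Proof. by rewrite probability_setT ltry. Qed.

Hypothesis fairP : fair P.

(** Reindexing along an injection maps the event that given coins show heads to
    an event of the same form with as many coins. *)
Lemma fair_reindex (f : I -> I) : injective f ->
  forall A : set (coins I), measurable A ->
    P ((fun y : coins I => (y \o f : coins I)) @^-1` A) = P A.
Proof.
move=> injf A mA.
have mf := @measurable_reindex I I _ bool f.
pose X : {mfun coins I >-> coins I} := mfun_Sub (mem_set mf).
apply: (@coins_measure_unique I R (distribution P X) P) => //.
- move=> s us; apply: etrans (esym (fairP us)); rewrite -(size_map f).
  have us' : uniq (map f s) by rewrite map_inj_uniq.
  apply: etrans (fairP us'); congr (P _); apply/seteqP; split=> y /= H i.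
    by move=> /mapP[j sj ->]; apply: H.
  by move=> si; apply: H; apply: map_f.
Qed.

(** Gluing two independent copies of the coins along [D] and its complement
    gives fair coins again, so that events that look at disjoint sets of coins
    become the two factors of a product event. *)
Lemma fair_independent (D : set I) (A B : set (coins I)) :
  measurable A -> measurable B -> determined D A -> determined (~` D) B ->
  P (A `&` B) = (P A * P B)%E.
Proof.
move=> mA mB AD BD.
pose glue (xy : coins I * coins I) : coins I :=
  fun i => if `[< D i >] then xy.1 i else xy.2 i.
have mglue : measurable_fun setT glue.
  apply: measurable_to_product => i; rewrite /glue; case: asboolP => _.
    exact: (measurableT_comp (@measurable_proj I _ bool i) measurable_fst).
  exact: (measurableT_comp (@measurable_proj I _ bool i) measurable_snd).
pose X : {mfun (coins I * coins I)%type >-> coins I} := mfun_Sub (mem_set mglue).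
have glueP C : measurable C -> (P \x P)%E (glue @^-1` C) = P C.
  move=> mC; apply: (@coins_measure_unique I R (pushforward (P \x P)%E X) P) => //.
  - move=> s us; pose s1 := [seq i <- s | `[< D i >]].
    pose s2 := [seq i <- s | ~~ `[< D i >]].
    transitivity ((P \x P)%E
      ([set y : coins I | {in s1, forall i, y i}] `*`
       [set y : coins I | {in s2, forall i, y i}])).
      congr ((P \x P)%E _); apply/seteqP; split=> -[x y] /=.
        move=> H; split=> i; rewrite mem_filter => /andP[Di /H];
          by rewrite /= /glue /= ?Di // (negbTE Di).
      move=> [H1 H2] i si; rewrite /glue /=.
      by case E: `[< D i >]; [apply: H1|apply: H2]; rewrite mem_filter E si.
    rewrite product_measure1E; last 2 first.
    + exact: (measurable_cylinder s1 (fun=> true)).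
    + exact: (measurable_cylinder s2 (fun=> true)).
    apply: etrans (esym (fairP us)).
    have us1 := filter_uniq (fun i => `[< D i >]) us.
    have us2 := filter_uniq (fun i => ~~ `[< D i >]) us.
    apply: (etrans (f_equal2 mule (fairP us1) (fairP us2))).
    rewrite -EFinM -exprD; congr ((_ ^+ _)%:E).
    by rewrite !size_filter count_predC.
  - have h : ((P \x P)%E setT < +oo)%E.
      have PP : (P setT * P setT < +oo)%E.
        by rewrite probability_setT mul1e ltry.
      by rewrite -setXTT product_measure1E //; exact: PP.
    exact: h.
rewrite -glueP; last exact: measurableI.
rewrite -product_measure1E //; congr ((P \x P)%E _).
apply/seteqP; split=> -[x y] /=; rewrite /glue /=.
  move=> [Ax By]; split.
    by move: Ax; rewrite (AD _ x) // => i Di /=; rewrite asboolT.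
  by move: By; rewrite (BD _ y) // => i Di /=; rewrite asboolF.
move=> [Ax By]; split.
  by rewrite (AD _ x) // => i Di /=; rewrite asboolT.
by rewrite (BD _ y) // => i Di /=; rewrite asboolF.
Qed.

End fair_theory.

Lemma fair_coins (I : countType) (R : realType) :
  exists P : probability (coins I) R, fair P.
Proof.
have [Q fQ] := fair_coins_nat R.
have mf := @measurable_reindex nat I _ bool (@pickle I).
pose X : {mfun coins nat >-> coins I} := mfun_Sub (mem_set mf).
exists (distribution Q X) => s us.
have us' : uniq (map (@pickle I) s).
  by rewrite map_inj_uniq //; exact: (pcan_inj pickleK).
rewrite -(size_map (@pickle I)); apply: etrans (fQ _ us').
congr (Q _); apply/seteqP; split=> y /= H i.
  by move=> /mapP[j sj ->]; apply: H.
by move=> si; apply: H; apply: map_f.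
Qed.

(** * Mixing of fair coins *)

Section real_probability.
Context d (T : measurableType d) (R : realType) (P : probability T R).
Implicit Types A B : set T.

Definition pr A : R := fine (P A).

Lemma prE A : measurable A -> P A = (pr A)%:E.
Proof. by move=> mA; rewrite fineK // fin_num_measure. Qed.

Lemma pr_ge0 A : 0 <= pr A.
Proof. exact/fine_ge0/measure_ge0. Qed.

Lemma le_pr A B : measurable A -> measurable B -> A `<=` B -> pr A <= pr B.
Proof.
move=> mA mB AB; rewrite -lee_fin -!prE //.
by apply: le_measure; rewrite ?inE.
Qed.

Lemma pr_setU A B : measurable A -> measurable B -> pr (A `|` B) <= pr A + pr B.
Proof.
move=> mA mB; rewrite -lee_fin EFinD -!prE //; first exact: measureU2.
exact: measurableU.
Qed.

Lemma pr_setC A : measurable A -> pr (~` A) = 1 - pr A.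
Proof.
move=> mA; apply: EFin_inj; rewrite -prE; last exact: measurableC.
by rewrite probability_setC // prE // EFinB.
Qed.

Lemma pr_bigcup_le (A : nat -> set T) (b : nat -> R) (c : R) :
  (forall n, measurable (A n)) -> (forall n, pr (A n) <= b n) ->
  (forall n, \sum_(i < n) b i <= c) -> pr (\bigcup_n A n) <= c.
Proof.
move=> mA Ab bc; have mU : measurable (\bigcup_n A n) by exact: bigcupT_measurable.
rewrite -lee_fin -prE //.
apply: le_trans (generalized_Boole_inequality P mA mU) _.
apply: lime_le.
  by apply: is_cvg_nneseries => n _ _; exact: measure_ge0.
near=> n; apply: (@le_trans _ _ ((\sum_(i < n) b i)%:E)); last by rewrite lee_fin.
rewrite big_mkord -sumEFin; apply: lee_sum => i _.
by have := Ab i; rewrite -lee_fin -(prE (mA i)).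
Unshelve. all: by end_near.
Qed.

End real_probability.

(** Continuity from below, in the form used for approximations. *)
Lemma pr_bigcup_tail d (T : measurableType d) (R : realType)
    (P : probability T R) (F : nat -> set T) (e : R) :
  (forall n, measurable (F n)) -> 0 < e ->
  exists N, pr P (\bigcup_n F n `\` \big[setU/set0]_(i < N) F i) <= e.
Proof.
move=> mF e0; pose G n := \big[setU/set0]_(i < n.+1) F i.
have mG n : measurable (G n) by exact: bigsetU_measurable.
have mU : measurable (\bigcup_n F n) by exact: bigcupT_measurable.
have UG : \bigcup_n G n = \bigcup_n F n.
  by rewrite bigcup_bigsetU_bigcup.
have ndG : nondecreasing_seq G.
  by move=> m n mn; apply/subsetPset/subset_bigsetU.
have : (P \o G @ \oo --> P (\bigcup_n F n)).
  by rewrite -UG; apply: nondecreasing_cvg_mu => //; rewrite UG.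
rewrite prE // => /fine_cvgP[_ /cvgrPdist_le /(_ _ e0)[N _ /(_ N (leqnn N))]] /=.
rewrite -/(pr P (G N)) => H; exists N.+1.
rewrite -/(G N) (le_trans _ H) // (le_trans _ (ler_norm _)) //.
rewrite lerBrDr -lee_fin EFinD -!prE //; last exact: measurableD.
rewrite -measureU //; last by rewrite setDKI.
  rewrite setDKU // -UG; exact: (@bigcup_sup _ _ N setT G).
exact: measurableD.
Qed.

Section approximation.
Variables (I : eqType) (R : realType) (P : probability (coins I) R).

Definition symd (T : Type) (A B : set T) := (A `\` B) `|` (B `\` A).

Lemma measurable_symd d (T : measurableType d) (A B : set T) :
  measurable A -> measurable B -> measurable (symd A B).
Proof. by move=> mA mB; apply: measurableU; exact: measurableD. Qed.

Lemma measurable_determined_set (s : seq I) (A : set (coins I)) :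
  determined [set` s] A -> measurable A.
Proof. by move=> sA; exact: (@measurable_determined I Prop s A [set b : Prop | b] sA). Qed.

(** Sets approximated in measure by finitely determined ones form a
    sigma-algebra. *)
Lemma approx_determined (A : set (coins I)) (e : R) : measurable A -> 0 < e ->
  exists (s : seq I) (A' : set (coins I)),
    determined [set` s] A' /\ pr P (symd A A') <= e.
Proof.
move=> mA; move: A mA e.
pose C (A : set (coins I)) := measurable A /\ forall e, 0 < e ->
  exists (s : seq I) (A' : set (coins I)),
    determined [set` s] A' /\ pr P (symd A A') <= e.
suff H : measurable `<=` C by move=> A /H[].
have CE (s : seq I) (A : set (coins I)) : determined [set` s] A -> C A.
  move=> sA; split; first exact: (measurable_determined_set sA).
  move=> e e0; exists s, A; split=> //.
  by rewrite /symd setDv setU0 /pr measure0 ltW.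
have CU A B : C A -> C B -> C (A `|` B).
  move=> [mA CA] [mB CB]; split; first exact: measurableU.
  move=> e e0; have e2 : 0 < e / 2 by lra.
  have [s [A' [sA' HA]]] := CA _ e2; have [t [B' [tB' HB]]] := CB _ e2.
  exists (s ++ t), (A' `|` B'); split.
    move=> x y xy; rewrite /setU /= (sA' x y) ?(tB' x y) // => i /= si; apply: xy;
      by rewrite /= mem_cat si ?orbT.
  have mA' := measurable_determined_set sA'.
  have mB' := measurable_determined_set tB'.
  have m1 := measurable_symd mA mA'; have m2 := measurable_symd mB mB'.
  apply: (@le_trans _ _ (pr P (symd A A' `|` symd B B'))).
    apply: le_pr; first by apply: measurable_symd; exact: measurableU.
      exact: measurableU.
    by move=> x; rewrite /symd /=; tauto.
  by apply: le_trans (pr_setU _ m1 m2) _; lra.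
have C0 : C set0 by apply: (CE [::]).
have mE : @measurable _ (coins I) = <<s @cylinders I _ bool >> by [].
rewrite mE; apply: smallest_sub; last first.
  (* generators look at a single coin *)
  move=> _ [i _ [B _ <-]]; apply: (CE [:: i]) => x y xy /=.
  by rewrite /preimage /= (xy i) //= inE.
split=> //.
- move=> A [mA CA]; rewrite setTD; split; first exact: measurableC.
  move=> e e0; have [s [A' [sA' HA]]] := CA _ e0.
  exists s, (~` A'); split; first by move=> x y xy; rewrite /setC /= (sA' x y).
  rewrite (_ : symd _ _ = symd A A') //.
  by apply/seteqP; split=> x; rewrite /symd /=; have := pselect (A x);
    have := pselect (A' x); tauto.
- change (forall F : nat -> set (coins I), (forall i, C (F i)) -> C (\bigcup_n F n)).
  move=> F CF.
  have mF n : measurable (F n) by have [] := CF n.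
  have mU : measurable (\bigcup_n F n) by exact: bigcupT_measurable.
  split=> // e e0; have e2 : 0 < e / 2 by lra.
  have [N HN] := pr_bigcup_tail P mF e2.
  have : C (\big[setU/set0]_(i < N) F i).
    by elim/big_ind: _ => // i _; exact: CF.
  move=> [mG /(_ _ e2)[s [A' [sA' HA]]]]; exists s, A'; split=> //.
  have mA' := measurable_determined_set sA'.
  have m1 := measurable_symd mG mA'; have m2 := measurableD mU mG.
  set G := \big[setU/set0]_(i < N) F i in HN HA mG m1 m2 *.
  have GU : G `<=` \bigcup_n F n by rewrite /G; exact: bigsetU_bigcup.
  apply: (@le_trans _ _ (pr P (((\bigcup_n F n) `\` G) `|` symd G A'))).
    apply: le_pr; [exact: measurable_symd|exact: measurableU|].
    move=> x; rewrite /symd /= => -[[Fx A'x]|[A'x nFx]].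
      by have [Gx|nGx] := pselect (G x); [right; left|left].
    by right; right; split=> // /GU.
  by apply: le_trans (pr_setU _ m2 m1) _; lra.
Qed.

End approximation.

Section mixing.
Variables (I : eqType) (R : realType) (P : probability (coins I) R).
Hypothesis fairP : fair P.

Lemma pr_symd_le (A B : set (coins I)) : measurable A -> measurable B ->
  `|pr P A - pr P B| <= pr P (symd A B).
Proof.
move=> mA mB.
have H C D : measurable C -> measurable D -> pr P C <= pr P D + pr P (symd C D).
  move=> mC mD; have ms := measurable_symd mC mD.
  apply: le_trans (pr_setU _ mD ms); apply: le_pr => //; first exact: measurableU.
  move=> x Cx; have [Dx|nDx] := pselect (D x); first by left.
  by right; left.
have sC : symd B A = symd A B by rewrite /symd setUC.
have := H A B mA mB; have := H B A mB mA; rewrite sC => h1 h2.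
by rewrite ler_norml; apply/andP; split; lra.
Qed.

(** Reindexings that eventually move every coin away from any given one
    decorrelate events, because up to a small error events look at finitely
    many coins. *)
Lemma fair_mixing (f : nat -> I -> I) (A B : set (coins I)) :
  (forall n, injective (f n)) ->
  (forall i j, \forall n \near \oo, f n i <> j) ->
  measurable A -> measurable B ->
  let T n := fun y : coins I => (y \o f n : coins I) in
  (`| P (A `&` T n @^-1` B) - P A * P (T n @^-1` B) |)%E @[n --> \oo] --> 0%E.
Proof.
move=> injf farf mA mB T.
have mT n C : measurable C -> measurable (T n @^-1` C).
  move=> mC; rewrite -[X in measurable X]setTI.
  exact: (@measurable_reindex I I _ bool (f n) measurableT C mC).
have prT n C : measurable C -> pr P (T n @^-1` C) = pr P C.
  by move=> mC; rewrite /pr (fair_reindex fairP).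
suff H : (pr P (A `&` T n @^-1` B) - pr P A * pr P B) @[n --> \oo] --> (0 : R).
  rewrite (_ : (fun n => _) = EFin \o (fun n =>
      `|pr P (A `&` T n @^-1` B) - pr P A * pr P B|)).
    apply: cvg_EFin; first by apply: nearW => n /=.
    have H' := cvg_norm H; rewrite normr0 in H'; exact: H'.
  apply/funext => n /=.
  have mI : measurable (A `&` T n @^-1` B) by apply: measurableI => //; exact: mT.
  by rewrite (prE P mI) (prE P mA) (prE P (mT n B mB)) (prT n B mB).
apply/cvgrPdist_le => e e0.
have e4 : 0 < e / 4 by lra.
have [s [A' [sA' HA]]] := approx_determined P mA e4.
have [t [B' [tB' HB]]] := approx_determined P mB e4.
have mA' := measurable_determined_set sA'.
have mB' := measurable_determined_set tB'.
have : \forall n \near \oo, forall i j, i \in t -> j \in s -> f n i <> j.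
  have far1 i : \forall n \near \oo, forall j, j \in s -> f n i <> j.
    elim: s {sA'} => [|j s IH]; first exact: nearW.
    near=> n => j'; rewrite inE => /orP[/eqP ->|]; first by near: n; exact: farf.
    by move: j'; near: n.
  elim: t {tB'} => [|i t IH]; first exact: nearW.
  near=> n => i' j; rewrite inE => /orP[/eqP ->|]; first by move: j; near: n.
  by move: i' j; near: n.
apply: filterS => n far.
have ind : pr P (A' `&` T n @^-1` B') = pr P A' * pr P B'.
  apply: EFin_inj; rewrite EFinM -!prE //; last first.
    by apply: measurableI => //; exact: mT.
  rewrite -[P B'](fair_reindex fairP (injf n)) //.
  apply: (fair_independent fairP (D := [set` s])) => //; first exact: mT.
  move=> x y xy; apply: tB' => i it /=; apply: xy => /= fs.
  exact: far it fs erefl.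
have mI : measurable (A `&` T n @^-1` B) by apply: measurableI => //; exact: mT.
have mI' : measurable (A' `&` T n @^-1` B') by apply: measurableI => //; exact: mT.
have h1 : `|pr P (A `&` T n @^-1` B) - pr P (A' `&` T n @^-1` B')| <= e / 4 + e / 4.
  apply: le_trans (pr_symd_le mI mI') _.
  have m1 := measurable_symd mA mA'.
  have m2 := measurable_symd mB mB'.
  apply: (@le_trans _ _ (pr P (symd A A' `|` T n @^-1` (symd B B')))).
    apply: le_pr; first exact: measurable_symd.
      by apply: measurableU => //; exact: mT.
    by move=> x; rewrite /symd /=; have := pselect (A x); have := pselect (A' x);
      have := pselect (B (T n x)); have := pselect (B' (T n x)); tauto.
  by apply: le_trans (pr_setU _ m1 (mT n _ m2)) _; rewrite prT //; lra.
have h2 := le_trans (pr_symd_le mA mA') HA.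
have h3 := le_trans (pr_symd_le mB mB') HB.
have p1 (C : set (coins I)) : measurable C -> pr P C <= 1.
  move=> mC; rewrite -lee_fin -prE //; exact: probability_le1.
have := (p1 _ mA, p1 _ mB, p1 _ mA', p1 _ mB').
have := (pr_ge0 P A, pr_ge0 P B, pr_ge0 P A', pr_ge0 P B').
rewrite ind in h1; move: h1 h2 h3; rewrite sub0r normrN.
move: (pr P _) (pr P _) (pr P _) (pr P _) (pr P _) => x a' b' a b h1 h2 h3.
move=> [[[a0 b0] a'0] b'0] [[[a1 b1] a'1] b'1].
rewrite !ler_norml in h1 h2 h3 *; move: h1 h2 h3 => /andP[h1 h1'] /andP[h2 h2'] /andP[h3 h3'].
by apply/andP; split; nra.
Unshelve. all: by end_near.
Qed.

End mixing.

(** * Markov chains and supersolutions *)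

Section finite_unions.
Context d (T : measurableType d) (R : realType) (P : probability T R).

Lemma pr_bigsetU_le (J : Type) (s : seq J) (F : J -> set T) :
  (forall j, measurable (F j)) ->
  pr P (\big[setU/set0]_(j <- s) F j) <= \sum_(j <- s) pr P (F j).
Proof.
move=> mF; elim: s => [|j s IH]; first by rewrite !big_nil /pr measure0.
rewrite !big_cons (le_trans (pr_setU P (mF j) _)) ?lerD2l //.
by apply: bigsetU_measurable.
Qed.

Lemma pr_disjU (A B : set T) : measurable A -> measurable B -> A `&` B = set0 ->
  pr P (A `|` B) = pr P A + pr P B.
Proof.
move=> mA mB AB0; apply: EFin_inj.
rewrite EFinD -!prE //; first exact: probability_setU.
exact: measurableU.
Qed.

Lemma pr_bigsetU_disj (J : choiceType) (s : seq J) (F : J -> set T) :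
  (forall j, measurable (F j)) -> uniq s ->
  (forall i j, i != j -> F i `&` F j = set0) ->
  pr P (\big[setU/set0]_(j <- s) F j) = \sum_(j <- s) pr P (F j).
Proof.
move=> mF + disF; elim: s => [|j s IH]; first by rewrite !big_nil /pr measure0.
move=> /= /andP[js us]; rewrite !big_cons pr_disjU ?IH //.
  exact: bigsetU_measurable.
apply/seteqP; split=> // x [Fj]; rewrite -bigcup_seq => -[i /= si Fi].
have ij : i != j by apply: contraNneq js => <-.
have : (F i `&` F j) x by [].
by rewrite disF.
Qed.

Lemma pr_diff (A B : set T) : measurable A -> measurable B -> B `<=` A ->
  pr P (A `\` B) = pr P A - pr P B.
Proof.
move=> mA mB BA; have := @pr_disjU (A `\` B) B (measurableD mA mB) mB.
by rewrite setDKU // setDKI => /(_ erefl) ->; rewrite addrK.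
Qed.

Lemma prT : pr P setT = 1.
Proof. by rewrite /pr probability_setT. Qed.

End finite_unions.

Section markov.
Variables (R : realType) (w : Z2 -> S2 R) (v : Z2).
Variable mu : probability path_space R.
Hypothesis mu_walk : walk_law w v mu.

Definition follows (t : nat) (p : nat -> Z2) : set path_space :=
  [set X | forall s, (s <= t)%N -> X s = p s].

Definition shift_path (t : nat) (X : path_space) : path_space :=
  fun s => X (t + s)%N.

Lemma measurable_position (t : nat) (A : set Z2) :
  measurable [set X : path_space | A (X t)].
Proof.
rewrite -[X in measurable X]setTI.
exact: (@measurable_proj nat _ Z2 t measurableT A).
Qed.

Lemma measurable_shift_path t (A : set path_space) :
  measurable A -> measurable (shift_path t @^-1` A).
Proof.
move=> mA; rewrite -[X in measurable X]setTI.
exact: (@measurable_reindex nat nat _ Z2 (addn t) measurableT A).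
Qed.

Lemma measurable_follows t p : measurable (follows t p).
Proof.
rewrite (_ : follows t p = \bigcap_(s in [set s | (s <= t)%N])
    [set X : path_space | X s = p s]).
  apply: bigcap_measurable; first by exists 0%N.
  by move=> s _; exact: (measurable_position s [set p s]).
by apply/seteqP; split=> X H s; exact: H.
Qed.

Definition extend (t : nat) (p : nat -> Z2) (u : Z2) : nat -> Z2 :=
  fun s => if (s <= t)%N then p s else u.

Lemma follows_extend t p (e : dir) : follows t.+1 (extend t p (p t + val e)) =
  [set X : path_space | (forall s, (s <= t)%N -> X s = p s) /\
     X t.+1 = p t + val e].
Proof.
apply/seteqP; split=> X /=.
  move=> H; split; last by rewrite H // /extend ltnn.
  by move=> s st; rewrite H ?leqW // /extend st.
move=> [H1 H2] s; rewrite leq_eqVlt => /orP[/eqP ->|st].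
  by rewrite H2 /extend ltnn.
by rewrite H1 // /extend -ltnS st.
Qed.

Lemma weight_sum (u : Z2) : \sum_(e : dir) w u e = 1.
Proof. by have /andP[_ /eqP] := weightP (w u). Qed.

Lemma pr_follows_extend t p (e : dir) :
  pr mu (follows t.+1 (extend t p (p t + val e))) =
  pr mu (follows t p) * w (p t) e.
Proof.
apply: EFin_inj; rewrite EFinM -!prE; try exact: measurable_follows.
by rewrite follows_extend; case: mu_walk => _ ->.
Qed.

(** By induction on the number of remaining steps: conditionally on the past,
    one more step averages [F n] over the neighbours. At points where [F] is at
    least 1 the bound is trivial, so the inequality between [F n] and [F n.+1]
    is required elsewhere only. *)
Lemma markov_bound_past (F : nat -> Z2 -> R) (E : nat -> set path_space) :
  (forall n u, 0 <= F n u) -> (forall n, measurable (E n)) ->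
  (forall X, E 0%N X -> 1 <= F 0%N (X 0%N)) ->
  (forall n X, E n.+1 X -> 1 <= F n.+1 (X 0%N) \/
     (E n (shift_path 1 X) /\
      \sum_(e : dir) w (X 0%N) e * F n (X 0%N + val e) <= F n.+1 (X 0%N))) ->
  forall n t p, pr mu (follows t p `&` shift_path t @^-1` E n) <=
    pr mu (follows t p) * F n (p t).
Proof.
move=> F0 mE E0 ES; elim=> [|n IH] t p; set C := follows t p.
all: have mC : measurable C by exact: measurable_follows.
all: have mI m : measurable (C `&` shift_path t @^-1` E m)
    by apply: measurableI => //; exact: measurable_shift_path.
all: have triv m : 1 <= F m (p t) ->
       pr mu (C `&` shift_path t @^-1` E m) <= pr mu C * F m (p t)
  by move=> h; apply: (@le_trans _ _ (pr mu C));
     [apply: le_pr => // x []|rewrite ler_peMr // pr_ge0].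
all: have Xt X : C X -> shift_path t X 0%N = p t
  by move=> CX; rewrite /shift_path addn0; exact: CX.
  have [/triv//|nF] := pselect (1 <= F 0%N (p t)).
  rewrite (_ : _ `&` _ = set0) ?/pr ?measure0 ?mulr_ge0 ?pr_ge0 //.
  by apply/seteqP; split=> // X [/Xt CX /E0]; rewrite CX.
have [/triv//|nF] := pselect (1 <= F n.+1 (p t)).
have [sup|nsup] := pselect (\sum_(e : dir) w (p t) e * F n (p t + val e) <= F n.+1 (p t));
    last first.
  rewrite (_ : _ `&` _ = set0) ?/pr ?measure0 ?mulr_ge0 ?pr_ge0 //.
  by apply/seteqP; split=> // X [/Xt CX /ES]; rewrite CX => -[//|[]].
pose Ce (e : dir) := follows t.+1 (extend t p (p t + val e)).
have mCe (e : dir) : measurable (Ce e) by exact: measurable_follows.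
pose U := \big[setU/set0]_(e : dir) Ce e.
have mU : measurable U by exact: bigsetU_measurable.
have UC : U `<=` C.
  move=> X; rewrite /U -bigcup_seq => -[e _]; rewrite /Ce follows_extend => -[] //.
have prU : pr mu U = pr mu C.
  rewrite pr_bigsetU_disj ?index_enum_uniq //.
    under eq_bigr do rewrite pr_follows_extend.
    by rewrite -mulr_sumr weight_sum mulr1.
  move=> e e' ee'; apply/seteqP; split=> // X; rewrite /Ce !follows_extend => -[].
  move=> /= [_ ->] [_ /addrI /val_inj eE]; by rewrite eE eqxx in ee'.
pose Ge (e : dir) := Ce e `&` shift_path t.+1 @^-1` E n.
have mGe (e : dir) : measurable (Ge e).
  by apply: measurableI => //; exact: measurable_shift_path.
have sub : C `&` shift_path t @^-1` E n.+1 `<=`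
    (C `\` U) `|` \big[setU/set0]_(e : dir) Ge e.
  move=> X [CX EX]; have [UX|nUX] := pselect (U X); last by left.
  right; move: UX; rewrite /U -!bigcup_seq => -[e ee Cee]; exists e => //.
  split=> //; have [|[+ _]] := ES _ _ EX; first by rewrite Xt.
  rewrite (_ : shift_path 1 _ = shift_path t.+1 X) //.
  by apply/funext => s; rewrite /shift_path addnA addn1.
have mGU : measurable (\big[setU/set0]_(e : dir) Ge e) by exact: bigsetU_measurable.
apply: le_trans (le_pr mu (mI n.+1) _ sub) _.
  by apply: measurableU => //; exact: measurableD.
apply: le_trans (pr_setU mu (measurableD mC mU) mGU) _.
rewrite pr_diff // prU subrr add0r.
apply: le_trans (pr_bigsetU_le mu _ mGe) _.
apply: le_trans (ler_wpM2l (pr_ge0 mu C) sup).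
rewrite mulr_sumr; apply: ler_sum => e _.
apply: le_trans (IH _ _) _.
by rewrite pr_follows_extend /extend ltnn mulrA.
Qed.

Lemma markov_bound (F : nat -> Z2 -> R) (E : nat -> set path_space) :
  (forall n u, 0 <= F n u) -> (forall n, measurable (E n)) ->
  (forall X, E 0%N X -> 1 <= F 0%N (X 0%N)) ->
  (forall n X, E n.+1 X -> 1 <= F n.+1 (X 0%N) \/
     (E n (shift_path 1 X) /\
      \sum_(e : dir) w (X 0%N) e * F n (X 0%N + val e) <= F n.+1 (X 0%N))) ->
  forall n, pr mu (E n) <= F n v.
Proof.
move=> F0 mE E0 ES n.
have := markov_bound_past F0 mE E0 ES n 0%N (fun=> v).
set C := follows _ _.
have mC : measurable C by exact: measurable_follows.
have CE : C = [set X | X 0%N = v].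
  apply/seteqP; split=> X /=; first exact.
  by move=> X0 s; rewrite leqn0 => /eqP ->.
have prC : pr mu C = 1 by rewrite /pr CE mu_walk.1.
rewrite prC mul1r; apply: le_trans.
have mEn := mE n; have mI := measurableI _ _ mC mEn.
apply: (@le_trans _ _ (pr mu (C `&` E n `|` ~` C))).
  apply: le_pr => //; first by apply: measurableU => //; exact: measurableC.
  by move=> X EX; have [CX|] := pselect (C X); [left|right].
apply: le_trans (pr_setU mu mI (measurableC mC)) _.
rewrite pr_setC // prC subrr addr0; exact: lexx.
Qed.

End markov.

Definition drifts (l : Z2 -> int) : set path_space :=
  [set X | forall K : nat, exists N, forall n, (N <= n)%N -> K%:Z < l (X n)].

Lemma measurable_drifts l : measurable (drifts l).
Proof.
rewrite (_ : drifts l = \bigcap_(K in [set: nat]) \bigcup_(N in [set: nat])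
    \bigcap_(n in [set n | (N <= n)%N]) [set X : path_space | K%:Z < l (X n)]).
  apply: bigcap_measurable; first by exists 0%N.
  move=> K _; apply: bigcup_measurable => N _.
  apply: bigcap_measurable; first by exists N => /=.
  by move=> n _; exact: (measurable_position n [set u | K%:Z < l u]).
apply/seteqP; split=> X /= H K.
  by move=> _; have [N HN] := H K; exists N.
by have [N _ HN] := H K Logic.I; exists N.
Qed.

Section escape.
Variables (R : realType) (w : Z2 -> S2 R) (v : Z2).
Variable mu : probability path_space R.
Hypothesis mu_walk : walk_law w v mu.
Variables (h : Z2 -> R) (l : Z2 -> int) (b rho : R).
Hypothesis h0 : forall u, 0 <= h u.
Hypothesis h_super : forall u, h u < 1 ->
  \sum_(e : dir) w u e * h (u + val e) <= h u.
Hypothesis lD : forall u (e : dir), l (u + val e) = l u + l (val e).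
Hypothesis b1 : 1 < b.
Hypothesis rho01 : 0 <= rho < 1.
Hypothesis l_super : forall u, h u < 1 ->
  \sum_(e : dir) w u e * b ^ (- l (val e)) <= rho.

Let hit (n : nat) : set path_space :=
  [set X | exists2 s, (s <= n)%N & 1 <= h (X s)].

Let low (K n : nat) : set path_space :=
  [set X | (forall s, (s <= n)%N -> h (X s) < 1) /\ l (X n) <= K%:Z].

Let m_hit n : measurable (hit n).
Proof.
rewrite (_ : hit n = \bigcup_(s in [set s | (s <= n)%N])
    [set X : path_space | 1 <= h (X s)]).
  by apply: bigcup_measurable => s _; exact: (measurable_position s [set u | 1 <= h u]).
by apply/seteqP; split=> X /= [s ? ?]; exists s.
Qed.

Let m_low K n : measurable (low K n).
Proof.
rewrite (_ : low K n = ~` hit n `&` [set X : path_space | l (X n) <= K%:Z]).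
  apply: measurableI; first by apply: measurableC; exact: m_hit.
  exact: (measurable_position n [set u | l u <= K%:Z]).
apply/seteqP; split=> X /= [H lX]; split=> //.
  by move=> [s /H]; rewrite leNgt => ->.
by move=> s sn; rewrite ltNge; apply/negP => hs; apply: H; exists s.
Qed.

Lemma pr_hit n : pr mu (hit n) <= h v.
Proof.
apply: (markov_bound mu_walk (F := fun=> h) (E := hit)) => //.
  by move=> X [s]; rewrite leqn0 => /eqP ->.
move=> k X [s sk hs]; have [|hX] := leP 1 (h (X 0%N)); first by left.
right; split; last exact: h_super.
case: s sk hs => [|s] sk hs; first by rewrite leNgt hX in hs.
by exists s.
Qed.

Let b0 : 0 < b. Proof. exact: lt_trans ltr01 b1. Qed.

Lemma pr_low K n : pr mu (low K n) <= b ^ (K%:Z - l v) * rho ^+ n.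
Proof.
have rho0 : 0 <= rho by case/andP: rho01.
apply: (markov_bound mu_walk (F := fun n u => b ^ (K%:Z - l u) * rho ^+ n)
    (E := low K)) => //.
- by move=> k u; rewrite mulr_ge0 ?exprn_ge0 // exprz_ge0 // ltW.
- move=> X [_ lX]; rewrite expr0 mulr1.
  have : 0 <= K%:Z - l (X 0%N) by rewrite subr_ge0.
  by case: (_ - _) => // j _; rewrite -exprnP exprn_ege1 // ltW.
move=> k X [hX lX]; right; split.
  by split=> // s sk; rewrite /shift_path; apply: hX; rewrite add1n.
have : \sum_(e : dir) w (X 0%N) e * b ^ (- l (val e)) <= rho.
  by apply: l_super; exact: hX.
have c0 : 0 <= b ^ (K%:Z - l (X 0%N)) * rho ^+ k.
  by rewrite mulr_ge0 ?exprn_ge0 // exprz_ge0 // ltW.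
move=> /(ler_wpM2l c0); rewrite mulr_sumr -mulrA -exprSr.
apply: le_trans; apply: ler_sum => e _.
rewrite lD opprD addrA expfzDr ?gt_eqF //.
set p := w _ _; set B := b ^ (K%:Z - _); set C := b ^ (- _).
by rewrite (_ : p * (B * C * _) = B * rho ^+ k * (p * C)) //; ring.
Qed.

Let geometric_small (c e : R) : 0 < e ->
  exists N, forall n, \sum_(i < n) c * rho ^+ (N + i) <= e.
Proof.
move=> e0; have /andP[r0 r1] := rho01.
have r10 : 0 < 1 - rho by rewrite subr_gt0.
have [c0|c0] := leP c 0.
  exists 0%N => n; apply: le_trans (ltW e0); apply: sumr_le0 => i _.
  by rewrite mulr_le0_ge0 ?exprn_ge0.
have : (rho ^+ n) @[n --> \oo] --> (0 : R) by apply: cvg_expr; rewrite ger0_norm.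
have d0 : 0 < e * (1 - rho) / c by rewrite divr_gt0 // mulr_gt0.
move=> /cvgrPdist_le /(_ _ d0)[N _ /(_ N (leqnn N))] /=.
rewrite sub0r normrN ger0_norm ?exprn_ge0 // => HN; exists N => n.
have -> : \sum_(i < n) c * rho ^+ (N + i) = c * rho ^+ N * \sum_(i < n) rho ^+ i.
  by rewrite mulr_sumr; apply: eq_bigr => i _; rewrite exprD mulrA.
have gs : (1 - rho) * \sum_(i < n) rho ^+ i <= 1.
  rewrite -opprB mulNr -subrX1 opprB gerBl exprn_ge0 //.
have q0 : 0 <= c * rho ^+ N by rewrite mulr_ge0 ?exprn_ge0 // ltW.
rewrite ler_pdivlMr // (mulrC _ c) in HN.
set S := \sum_(i < n) _ in gs *; rewrite -(ler_pM2r r10).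
apply: le_trans HN; rewrite -(mulrA (c * rho ^+ N)) (mulrC S).
by apply: ler_piMr.
Qed.

(** The event [hit n] has probability at most [h v] because [h] is a
    supersolution. As long as [h < 1] along the path, [b ^ (- l)] shrinks by the
    factor [rho] on average, so for each [K] the probabilities of the events
    [low K n] are summable in [n]. A path outside of all these events, from
    some time on for each [K], drifts to infinity. *)
Lemma escape : 1 - h v <= pr mu (drifts l).
Proof.
apply/ler_addgt0Pr => e e0.
have e2 : 0 < e / 2 by lra.
pose c K := b ^ (K%:Z - l v).
have eK K : 0 < e / 4 / 2 ^+ K by rewrite !divr_gt0 // exprn_gt0.
have [N HN] := choice (fun K => geometric_small (c K) (eK K)).
(* after time N K the walk stays above K, unless it is in L K or hits *)
pose L K := \bigcup_i low K (N K + i).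
have mL K : measurable (L K) by exact: bigcupT_measurable.
have prL K : pr mu (L K) <= e / 4 / 2 ^+ K.
  by apply: pr_bigcup_le (HN K) => // i; exact: pr_low.
pose LL := \bigcup_K L K.
have mLL : measurable LL by exact: bigcupT_measurable.
have prLL : pr mu LL <= e / 2.
  apply: pr_bigcup_le prL _ => // n.
  have -> : \sum_(i < n) e / 4 / 2 ^+ i = e / 2 * (1 - 2^-1 ^+ n).
    elim: n => [|n IH]; first by rewrite big_ord0 expr0 subrr mulr0.
    rewrite big_ord_recr /= IH exprS -exprVn; set q := 2^-1 ^+ n; by lra.
  by rewrite ger_pMr // gerBl exprn_ge0 // invr_ge0.
pose HH := \bigcup_n hit n.
have mHH : measurable HH by exact: bigcupT_measurable.
have prHH : pr mu HH <= h v + e / 2.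
  have [M HM] := pr_bigcup_tail mu m_hit e2.
  set G := \big[setU/set0]_(i < M) hit i in HM.
  have mG : measurable G by exact: bigsetU_measurable.
  have GM : G `<=` hit M.
    rewrite /G => X; rewrite -bigcup_mkord => -[i /= iM [s si hs]].
    by exists s => //; exact: leq_trans si (ltnW iM).
  apply: (@le_trans _ _ (pr mu (hit M `|` (HH `\` G)))).
    apply: le_pr => //; first by apply: measurableU => //; exact: measurableD.
    by move=> X HX; have [/GM|nG] := pselect (G X); [left|right].
  apply: le_trans (pr_setU mu (m_hit M) (measurableD mHH mG)) _.
  by apply: lerD => //; exact: pr_hit.
have mD := measurable_drifts l.
have mU : measurable (HH `|` LL) by exact: measurableU.
have : pr mu (~` (HH `|` LL)) <= pr mu (drifts l).
  apply: le_pr => //; first exact: measurableC.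
  move=> X nX K; exists (N K) => n Nn.
  have nh s : h (X s) < 1.
    rewrite ltNge; apply/negP => hs; apply: nX; left; exists s => //.
    by exists s.
  rewrite ltNge; apply/negP => lX; apply: nX; right; exists K => //.
  by exists (n - N K)%N => //; rewrite subnKC //; split.
rewrite pr_setC // => H1.
have := pr_setU mu mHH mLL; lra.
Qed.

End escape.

Lemma to_pinftyE (R : realType) : to_pinfty R = drifts (dotZ2 ^~ ones).
Proof.
apply/seteqP; split=> X /=.
  move=> /cvgryPge H K; have [N _ HN] := H K.+1%:R; exists N => n Nn.
  by have := HN n Nn; rewrite /= pmulrn ler_int; lia.
move=> H; apply/cvgryPge => A.
have [N HN] := H (Num.truncn A).+1; exists N => // n /= Nn.
apply: le_trans (ltW (truncnS_gt A)) _.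
by rewrite pmulrn ler_int ltW // HN.
Qed.

Lemma to_ninftyE (R : realType) : to_ninfty R = drifts (fun u => - dotZ2 u ones).
Proof.
apply/seteqP; split=> X /=.
  move=> /cvgrNyPle H K; have [N _ HN] := H (- K.+1%:R); exists N => n Nn.
  by have := HN n Nn; rewrite /= pmulrn -mulrNz ler_int; lia.
move=> H; apply/cvgrNyPle => A.
have [N HN] := H (Num.truncn (- A)).+1; exists N => // n /= Nn.
rewrite -lerN2; apply: le_trans (ltW (truncnS_gt _)) _.
by rewrite pmulrn -mulrNz ler_int ltW // HN.
Qed.

(** * The walk driven by coins *)

Lemma fair_cylinder (I : eqType) (R : realType) (P : probability (coins I) R)
    (s : seq I) (v : I -> bool) : fair P -> uniq s ->
  P [set y : coins I | {in s, forall i, y i = v i}] = ((2^-1) ^+ size s)%:E.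
Proof.
move=> fP; elim: s => [|j s IH] /=.
  move=> _; rewrite expr0 (_ : [set _ | _] = setT) ?probability_setT //.
  by apply/seteqP; split.
move=> /andP[js us].
have m1 b : measurable [set y : coins I | y j = b].
  have := @measurable_proj I _ bool j measurableT [set b].
  by rewrite setTI; apply.
have m2 := measurable_cylinder s v.
rewrite (_ : [set _ | _] = [set y : coins I | y j = v j] `&`
   [set y | {in s, forall i, y i = v i}]); last first.
  apply/seteqP; split=> y /=.
    by move=> H; split=> [|i si]; apply: H; rewrite inE ?eqxx ?si ?orbT.
  by move=> [H1 H2] i; rewrite inE => /orP[/eqP->|/H2].
rewrite (fair_independent fP (D := [set j]) (m1 _) m2); last 2 first.
- by move=> x y /(_ j erefl) /= xy; rewrite /mkset xy.
- move=> x y xy; rewrite /mkset; apply/propext.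
  by split=> H i si; rewrite -H //; [rewrite xy|rewrite -xy] => //= ij;
    rewrite -ij si in js.
have half b : P [set y : coins I | y j = b] = (2^-1)%:E.
  have T1 : P [set y : coins I | y j = true] = (2^-1)%:E.
    rewrite -[X in X%:E]expr1 -(fP [:: j] isT); congr (P _).
    apply/seteqP; split=> y /=; last by apply; rewrite inE.
    by move=> yj i; rewrite inE => /eqP ->.
  case: b => //; rewrite (_ : [set _ | _] = ~` [set y : coins I | y j = true]).
    rewrite probability_setC // T1 -EFinB; congr (_%:E); lra.
  by apply/seteqP; split=> y /=; case: (y j).
by rewrite IH // half -EFinM -exprS.
Qed.

(** A uniform element of [C] is thereby mapped to a random element of [E] with
    prescribed rational weights. *)
Lemma function_of_fibers (C E : finType) (c0 : C) (n : E -> nat) :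
  (\sum_e n e = #|C|)%N ->
  exists f : C -> E, forall e, #|[pred c | f c == e]| = n e.
Proof.
move=> nC; pose D := flatten [seq nseq (n e) e | e <- enum E].
have szD : size D = #|C|.
  rewrite size_flatten /shape -map_comp -nC sumnE big_map big_enum /=.
  by apply: eq_bigr => e _; rewrite size_nseq.
have cD e : count_mem e D = n e.
  rewrite count_flatten -map_comp sumnE big_map big_enum /= (bigD1 e) //=.
  rewrite count_nseq /= eqxx mul1n big1 ?addn0 // => e' e'e.
  by rewrite count_nseq /= (negbTE e'e).
have Cp : (0 < #|C|)%N by apply/card_gt0P; exists c0.
have [e0 _] : exists e0, e0 \in D.
  case: D szD {cD} => [/= D0|e0 D _]; first by rewrite -D0 in Cp.
  by exists e0; exact: mem_head.
exists (fun c => nth e0 D (index c (enum C))) => e.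
pose f c := nth e0 D (index c (enum C)).
have fD : map f (enum C) = D.
  apply: (@eq_from_nth _ e0); first by rewrite size_map -cardE szD.
  move=> i; rewrite size_map => ilt; rewrite (nth_map c0) // /f.
  by rewrite index_uniq ?enum_uniq.
have cardP (Q : pred C) : #|Q| = count Q (enum C).
  by rewrite cardE {1}/enum_mem size_filter -enumT.
by rewrite cardP -cD -[in RHS]fD count_map; apply: eq_count.
Qed.

Lemma measurable_fun_countable d (A : measurableType d) d' (B : measurableType d')
    (F : A -> Z2) (G : Z2 -> A -> B) :
  measurable_fun setT F -> (forall u, measurable_fun setT (G u)) ->
  measurable_fun setT (fun a => G (F a) a).
Proof.
move=> mF mG _ C mC; rewrite setTI.
rewrite (_ : _ @^-1` _ =
    \bigcup_(u in [set: Z2]) (F @^-1` [set u] `&` G u @^-1` C)).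
  apply: countable_bigcupT_measurable.
    exact: countableP.
  move=> u; apply: measurableI; rewrite -[X in measurable X]setTI.
    exact: mF.
  exact: mG.
apply/seteqP; split=> a /=; first by move=> Ca; exists (F a).
by move=> [u _ [<-]].
Qed.

Section kernel.
Variables (R : realType) (m : nat) (mu : probability (coins (nat * 'I_m)%type) R).
Hypothesis fair_mu : fair mu.
Variables (wt : Z2 -> S2 R) (N : Z2 -> dir -> nat).
Hypothesis wtE : forall d e, wt d e = (N d e)%:R / 2 ^+ m.
Variables (disp : measure_display) (Omega : measurableType disp).
Variable T : Z2 -> Omega -> Z2.
Hypothesis mT : forall u, measurable_fun setT (T u).

Let Coins := coins (nat * 'I_m)%type.

Definition block (t : nat) (c : Coins) : {ffun 'I_m -> bool} :=
  [ffun i => c (t, i)].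

Variable choose_step : Z2 -> {ffun 'I_m -> bool} -> dir.
Hypothesis choose_stepP : forall d e,
  #|[pred c | choose_step d c == e]| = N d e.

Fixpoint walk (x : Omega) (c : Coins) (t : nat) : Z2 :=
  if t is t'.+1 then
    let u := walk x c t' in u + val (choose_step (T u x) (block t' c))
  else 0.

Lemma eq_block t (c c' : Coins) : (forall i, c (t, i) = c' (t, i)) -> block t c = block t c'.
Proof. by move=> cc'; apply/ffunP => i; rewrite !ffunE. Qed.

Lemma eq_walk x t (c c' : Coins) :
  (forall s i, (s < t)%N -> c (s, i) = c' (s, i)) -> walk x c t = walk x c' t.
Proof.
elim: t => [//|t IH] cc'; rewrite [LHS]/= [RHS]/=.
rewrite IH; last by move=> s i st; apply: cc'; rewrite ltnW.
by rewrite (@eq_block t c c') // => i; exact: cc'.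
Qed.

Lemma measurable_walk :
  measurable_fun setT ((fun xc => walk xc.1 xc.2) : Omega * Coins -> path_space).
Proof.
apply: measurable_to_product; elim=> [|t IH]; first exact: measurable_cst.
apply: (measurable_fun_countable
  (G := fun u xc => u + val (choose_step (T u xc.1) (block t xc.2))) IH) => u.
apply: (measurable_fun_countable (F := fun xc => T u xc.1)
  (G := fun d xc => u + val (choose_step d (block t xc.2)))).
  exact: (measurableT_comp (mT u) measurable_fst).
move=> d; pose f (c : Coins) : Z2 := u + val (choose_step d (block t c)).
apply: (measurableT_comp (f := f) _ measurable_snd) => _ B _; rewrite setTI.
apply: (measurable_determined (s := [seq (t, i) | i <- enum 'I_m])).
move=> c c' cc'; rewrite /f (_ : block t c = block t c') //.
apply/ffunP => i; rewrite !ffunE; apply: cc' => /=.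
by apply: map_f; rewrite mem_enum.
Qed.

Lemma measurable_walk_at x : measurable_fun setT (walk x : Coins -> path_space).
Proof. exact: (measurableT_comp measurable_walk (pair1_measurable x)). Qed.

Definition walk_mfun x : {mfun Coins >-> path_space} :=
  mfun_Sub (mem_set (measurable_walk_at x)).

Definition walk_kernel (x : Omega) : {measure set path_space -> \bar R} :=
  distribution mu (walk_mfun x).

Let measurable_walk_kernel (U : set path_space) :
  measurable U -> measurable_fun [set: Omega] (walk_kernel ^~ U).
Proof.
move=> mU; pose A := (fun xc : Omega * Coins => walk xc.1 xc.2 : path_space) @^-1` U.
have mA : measurable A.
  by rewrite -[A]setTI; exact: measurable_walk.
have -> : walk_kernel ^~ U = mu \o xsection A.
  apply/funext => x /=; congr (mu _); apply/seteqP; split=> c /=;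
    by rewrite /xsection /= inE.
exact: measurable_fun_xsection.
Qed.

HB.instance Definition _ :=
  isKernel.Build _ _ _ _ _ walk_kernel measurable_walk_kernel.

Let walk_kernel1 x : walk_kernel x setT = 1%E.
Proof. exact: probability_setT. Qed.

HB.instance Definition _ :=
  Kernel_isProbability.Build _ _ _ _ _ walk_kernel walk_kernel1.

Lemma pr_block t (S : {pred {ffun 'I_m -> bool}}) :
  mu [set c : Coins | block t c \in S] = (#|S|%:R / 2 ^+ m)%:E.
Proof.
pose s := [seq (t, i) | i <- enum 'I_m].
have us : uniq s by rewrite map_inj_uniq ?enum_uniq // => i j [].
have szs : size s = m by rewrite size_map size_enum_ord.
have blockE b : [set c : Coins | block t c = b] =
    [set c : Coins | {in s, forall j, c j = b j.2}].
  apply/seteqP; split=> c /=.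
    by move=> <- _ /mapP[i _ ->]; rewrite ffunE.
  by move=> H; apply/ffunP => i; rewrite ffunE H // map_f // mem_enum.
have mb b : measurable [set c : Coins | block t c = b].
  by rewrite blockE; exact: measurable_cylinder.
have prb b : pr mu [set c : Coins | block t c = b] = (2 ^+ m)^-1.
  by rewrite /pr blockE fair_cylinder //= szs exprVn.
have E : [set c : Coins | block t c \in S] =
    \big[setU/set0]_(b <- enum S) [set c : Coins | block t c = b].
  rewrite -bigcup_seq; apply/seteqP; split=> c /=.
    by move=> bS; exists (block t c) => //=; rewrite mem_enum.
  by move=> [b /= + ->]; rewrite mem_enum.
rewrite E prE; last by apply: bigsetU_measurable.
rewrite pr_bigsetU_disj ?enum_uniq //; last first.
  move=> b b' bb'; apply/seteqP; split=> // c [/= ->] bE.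
  by rewrite bE eqxx in bb'.
under eq_bigr do rewrite prb.
by rewrite big_enum /= sumr_const -[_ *+ _]mulr_natl.
Qed.

(** The step at time [t] looks at the coins of block [t] only, whereas the path
    up to time [t] looks at earlier blocks. *)
Lemma walk_kernel_law x : walk_law (fun u => wt (T u x)) 0 (walk_kernel x).
Proof.
split.
  rewrite -(probability_setT mu); congr (mu _); apply/seteqP; split=> c //=.
move=> p t e.
pose A : set Coins := [set c | forall s, (s <= t)%N -> walk x c s = p s].
pose S := [pred b | choose_step (T (p t) x) b == e].
pose B : set Coins := [set c | block t c \in S].
have -> : walk_kernel x [set X | (forall s, (s <= t)%N -> X s = p s) /\
    X t.+1 = p t + val e] = mu (A `&` B).
  congr (mu _); apply/seteqP; split=> c /= [Ac].
    by move=> h; split=> //; move: h; rewrite Ac // => /addrI /val_inj ce;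
      rewrite /B /= inE; apply/eqP.
  by rewrite /B /= inE => /eqP h; split=> //; rewrite Ac // h.
have mA : measurable A.
  have := measurable_walk_at x measurableT (measurable_follows t p).
  by rewrite setTI.
have mB : measurable B.
  apply: (measurable_determined (s := [seq (t, i) | i <- enum 'I_m])
    (f := block t) [set b | b \in S]).
  move=> c c' cc'; apply: eq_block => i; apply: cc' => /=.
  by apply: map_f; rewrite mem_enum.
have -> : walk_kernel x [set X | forall s, (s <= t)%N -> X s = p s] = mu A by [].
have AD : determined [set ti : nat * 'I_m | (ti.1 < t)%N] A.
  move=> c c' cc'.
  have W s : (s <= t)%N -> walk x c s = walk x c' s.
    by move=> st; apply: eq_walk => q i qs; apply: cc'; exact: leq_trans st.
  by apply/propext; split=> H s st; [rewrite -W|rewrite W] => //; exact: H.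
have BD : determined (~` [set ti : nat * 'I_m | (ti.1 < t)%N]) B.
  move=> c c' cc'; rewrite /B /mkset (@eq_block t c c') // => i.
  by apply: cc'; rewrite /= ltnn.
by rewrite (fair_independent fair_mu mA mB AD BD) (pr_block t S) wtE -choose_stepP.
Qed.

End kernel.

(** * Nearest-neighbour laws with a small drift *)

Lemma sum_dir (V : nmodType) (F : Z2 -> V) :
  \sum_(e : dir) F (val e) = F e0 + F (- e0) + F e1 + F (- e1).
Proof.
pose s : seq Z2 := [:: e0; - e0; e1; - e1].
have -> : \sum_(e : dir) F (val e) = \sum_(x <- s) F x.
  rewrite -(big_map val predT F); apply: perm_big; apply: uniq_perm => //.
    by rewrite map_inj_uniq ?index_enum_uniq //; exact: val_inj.
  move=> x; apply/mapP/idP => [[e _ ->]|xs]; first exact: valP.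
  by exists (SeqSub xs); rewrite ?mem_index_enum.
by rewrite !big_cons big_nil addr0 !addrA.
Qed.

Section weights.
Variables (R : realType) (m : nat).

Definition delta : R := (2 ^+ m.+3)^-1.

Lemma delta_gt0 : 0 < delta. Proof. by rewrite invr_gt0 exprn_gt0. Qed.

Lemma delta_le8 : delta <= 8^-1.
Proof.
rewrite lef_pV2 ?posrE ?exprn_gt0 // -[m.+3]add3n exprD.
have : (1 : R) <= 2 ^+ m by apply: exprn_ege1; lra.
by rewrite (_ : 2 ^+ 3 = 8 :> R) ?exprS ?expr0; lra.
Qed.

Definition small_drift (d : Z2) : bool := (`|d.1| <= 2) && (`|d.2| <= 2).

Definition drift_weight (d : Z2) : {ffun dir -> R} :=
  [ffun e : dir => if small_drift d
     then 4^-1 + delta * (dotZ2 d (val e))%:~R else 4^-1].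

Lemma dot_dir (d : Z2) (e : dir) : small_drift d -> `|dotZ2 d (val e)| <= 2.
Proof.
case: d => a b /andP[/= a2 b2]; rewrite /dotZ2.
have := valP e; rewrite !inE => /or4P[] /eqP -> /=; lia.
Qed.

Lemma drift_weight_bounds (d : Z2) (e : dir) :
  4^-1 - 2 * delta <= drift_weight d e <= 4^-1 + 2 * delta.
Proof.
have d0 := delta_gt0; rewrite ffunE; case: ifP => [/(dot_dir e)|_]; last first.
  by apply/andP; split; lra.
rewrite ler_norml -!(ler_int R) => /andP[h1 h2].
have H1 := ler_wpM2l (ltW d0) h1; have H2 := ler_wpM2l (ltW d0) h2.
by apply/andP; split; rewrite rmorphN /= in H1; lra.
Qed.

Lemma drift_weight_simplex d : is_simplex (drift_weight d).
Proof.
have d8 := delta_le8; apply/andP; split.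
  apply/forallP => e; have := drift_weight_bounds d e; move: (drift_weight d e).
  by move=> x /andP[? ?]; apply/andP; split; lra.
pose F x := if small_drift d then 4^-1 + delta * (dotZ2 d x)%:~R else 4^-1.
have -> : \sum_(e : dir) drift_weight d e = \sum_(e : dir) F (val e).
  by apply: eq_bigr => e _; rewrite ffunE.
rewrite (sum_dir F) /F; case: (small_drift d); last by apply/eqP; lra.
rewrite /dotZ2 /= !(mulr0, mulr1, mulrN1, mulrN, add0r, addr0, oppr0) !rmorphN /=.
by apply/eqP; lra.
Qed.

Definition drift_law (d : Z2) : S2 R := MkS2 (drift_weight_simplex d).

(** The weights are multiples of [2 ^ - (m+3)], so that [m+3] coins decide one
    step of the walk. *)
Definition numerator (d : Z2) (e : dir) : nat :=
  if small_drift d then absz (2 ^+ m.+1 + dotZ2 d (val e)) else (2 ^ m.+1)%N.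

Lemma drift_lawE d (e : dir) : drift_law d e = (numerator d e)%:R / 2 ^+ m.+3.
Proof.
have two : (4^-1 : R) = 2 ^+ m.+1 / 2 ^+ m.+3.
  have : (2 ^+ m.+1 : R) != 0 by rewrite expf_neq0.
  rewrite (exprS _ m.+2) (exprS _ m.+1).
  by move: (2 ^+ m.+1) => x x0; field.
rewrite /= ffunE /numerator; case: ifP => sd; last first.
  by rewrite natrX two.
have p0 : 0 <= 2 ^+ m.+1 + dotZ2 d (val e).
  have := dot_dir e sd; have : (1 : int) <= 2 ^+ m by apply: exprn_ege1.
  by rewrite exprS; lia.
have -> : (absz (2 ^+ m.+1 + dotZ2 d (val e)))%:R =
    (2 ^+ m.+1 + dotZ2 d (val e))%:~R :> R by rewrite -{2}(gez0_abs p0).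
move: (dotZ2 _ _) => q; rewrite intrD mulrDl (rmorphXn (intmul 1)) /= -two.
by rewrite mulrC.
Qed.

Lemma sum_numerator d : (\sum_(e : dir) numerator d e = 2 ^ m.+3)%N.
Proof.
apply/eqP; rewrite -(eqr_nat R) natr_sum natrX.
have /andP[_ /eqP s1] := drift_weight_simplex d.
have c0 : (2 ^+ m.+3 : R) != 0 by rewrite expf_neq0.
have : (\sum_(e : dir) (numerator d e)%:R) / 2 ^+ m.+3 = 1 :> R.
  rewrite mulr_suml; apply: etrans s1; apply: eq_bigr => e _.
  by have := drift_lawE d e.
by move=> /(canRL (mulfVK c0)); rewrite mul1r => ->.
Qed.

Lemma sum_drift_law (d : Z2) (F : Z2 -> R) : small_drift d ->
  \sum_(e : dir) drift_law d e * F (val e) =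
  (4^-1 + delta * d.1%:~R) * F e0 + (4^-1 - delta * d.1%:~R) * F (- e0) +
  (4^-1 + delta * d.2%:~R) * F e1 + (4^-1 - delta * d.2%:~R) * F (- e1).
Proof.
move=> sd.
pose G x := (4^-1 + delta * (dotZ2 d x)%:~R) * F x.
have -> : \sum_(e : dir) drift_law d e * F (val e) = \sum_(e : dir) G (val e).
  by apply: eq_bigr => e _; rewrite /= ffunE sd.
rewrite (sum_dir G) /G /dotZ2 /= !(mulr0, mulr1, mulrN1, mulrN, add0r, addr0, oppr0).
by rewrite !rmorphN /= !mulrN.
Qed.

End weights.

(** * Supersolutions along a straight road and at a turn *)

Section supersolutions.
Variables (R : realType) (m : nat).

Local Notation delta := (delta R m).
Definition base : R := 1 + delta.
Local Notation E z := (base ^ z).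

Lemma base_gt1 : 1 < base.
Proof. by rewrite ltrDl delta_gt0. Qed.

Lemma base_gt0 : 0 < base.
Proof. exact: lt_trans ltr01 base_gt1. Qed.

Lemma basez_gt0 (z : int) : 0 < E z.
Proof. exact: exprz_gt0 base_gt0. Qed.

Lemma basezD (x y : int) : E (x + y) = E x * E y.
Proof. by rewrite expfzDr // gt_eqF // base_gt0. Qed.

Lemma basez1 : E 1 = 1 + delta. Proof. exact: expr1z. Qed.

Lemma basezN1 : E (-1) = base^-1. Proof. by []. Qed.

Lemma basez_le1 (z : int) : z <= 0 -> E z <= 1.
Proof. by move=> z0; rewrite -[leRHS](expr0z base) ler_eXz2l ?base_gt1. Qed.

Lemma basez_ge1 (z : int) : 0 <= z -> 1 <= E z.
Proof. by move=> z0; rewrite -[leLHS](expr0z base) ler_eXz2l ?base_gt1. Qed.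

Definition ch (y : int) : R := E y + E (- y).

(** Here [x <= 0] is the position along a road whose end is at 0 and [y] is the
    distance to its center line. The drift towards the center makes [ch y]
    superharmonic away from the center, and the linear term, which decreases
    in the direction of the road, makes up for the failure at the center. The
    prefactor makes the value at least 1 at distance [w] from the center. *)
Definition laneA (w : int) (x y : int) : R :=
  E (- w) * (ch y + 2 * (w - x - y)%:~R).

(** The analogue of [laneA] near the point where a road meets the next one,
    which points in the direction of [y] and begins at [x = 0]. As both roads
    push the walk to the right there, a factor that decreases exponentially in
    [x] compensates for the growth of [ch y] along the new road, and keeps the
    value above 1 on its left edge, except close to the mouth. *)
Definition turnB (w : int) (x y : int) : R := E (- w) * (ch y * E (- (x + x))).

Definition mean (d : Z2) (F : int -> int -> R) (x y : int) : R :=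
  (4^-1 + delta * d.1%:~R) * F (x + 1) y + (4^-1 - delta * d.1%:~R) * F (x - 1) y +
  (4^-1 + delta * d.2%:~R) * F x (y + 1) + (4^-1 - delta * d.2%:~R) * F x (y - 1).

Lemma meanD d F G x y :
  mean d (fun x y => F x y + G x y) x y = mean d F x y + mean d G x y.
Proof. by rewrite /mean; ring. Qed.

Lemma mean_cst d c x y : mean d (fun _ _ => c) x y = c.
Proof. by rewrite /mean; lra. Qed.

Let bV : exists2 b : R, base^-1 = b & b * (1 + delta) = 1 /\ 0 < b <= 1.
Proof.
have b0 := base_gt0; exists base^-1 => //; split.
  by rewrite -/base mulVf // gt_eqF.
by rewrite invr_gt0 b0 invf_le1 // ltW // base_gt1.
Qed.

Lemma laneA_super w x y d :
  (0 < y) && (d == (2, -1)) || (y <= 0) && (d == (1, 1)) ->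
  mean d (laneA w) x y <= laneA w x y.
Proof.
have d0 := delta_gt0 R m; have d8 := delta_le8 R m.
have [b bE [b1 /andP[b0 ble1]]] := bV.
have w0 := basez_gt0 (- w).
move=> hd.
suff : (4^-1 + delta * d.2%:~R) * ch (y + 1) + (4^-1 - delta * d.2%:~R) * ch (y - 1) +
   2^-1 * ch y - 4 * delta * (d.1 + d.2)%:~R <= ch y.
  rewrite /mean /laneA => H.
  rewrite -[leLHS](_ : E (- w) * ((4^-1 + delta * d.2%:~R) * ch (y + 1) +
    (4^-1 - delta * d.2%:~R) * ch (y - 1) +
   2^-1 * ch y - 4 * delta * (d.1 + d.2)%:~R + 2 * (w - x - y)%:~R) = _).
    by rewrite ler_wpM2l ?(ltW w0) // lerD2r.
  by rewrite !(intrD, intrB, rmorphN) /=; field.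
rewrite /ch !opprD !opprK !basezD basez1 basezN1 bE.
have b2 : b * delta + b * delta ^+ 2 = delta.
  by rewrite -[RHS]mul1r -[in RHS]b1; ring.
have dd : 0 <= delta ^+ 2 <= delta.
  rewrite expr2; apply/andP; split; first by rewrite mulr_ge0 // ltW.
  by apply: ler_piMr; lra.
have bdd : 0 <= b * delta ^+ 2 <= delta ^+ 2.
  move: dd => /andP[dd _]; apply/andP; split; last exact: ler_piMl.
  by rewrite mulr_ge0 ?(ltW b0).
move: (dd) (bdd) => /andP[dd0 dd1] /andP[bdd0 bdd1].
(* per step, the part of ch that grows outwards decreases, while the other
   part increases by at most 3 * delta ^ 2 times its value, which is below 1 *)
have coeff_in : (4^-1 - delta) * (1 + delta) + (4^-1 + delta) * b - 2^-1 <= 0 by lra.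
have coeff_out : (4^-1 - delta) * b + (4^-1 + delta) * (1 + delta) - 2^-1 <= 3 * delta.
  by lra.
have ya := basez_gt0 y; have yb := basez_gt0 (- y).
have [y0|y0] := ltP 0 y; move: hd; rewrite ?y0 ?(ltNge _ _) ?y0 ?(leNgt y) ?y0 /=.
  rewrite orbF => /eqP -> /=.
  have yb1 : E (- y) <= 1 by apply: basez_le1; rewrite oppr_le0 ltW.
  rewrite !rmorphN /=.
  move: (E y) (E (- y)) ya yb yb1 => p q p0 q0 q1.
  have := ler_wpM2l (ltW p0) coeff_in; have := ler_wpM2l (ltW q0) coeff_out.
  have : q * (3 * delta) <= 1 * (3 * delta) by apply: ler_wpM2r => //; lra.
  by lra.
move=> /eqP -> /=.
have ya1 : E y <= 1 by apply: basez_le1.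
move: (E y) (E (- y)) ya yb ya1 => p q p0 q0 p1.
have := ler_wpM2l (ltW q0) coeff_in; have := ler_wpM2l (ltW p0) coeff_out.
have : p * (3 * delta) <= 1 * (3 * delta) by apply: ler_wpM2r => //; lra.
by lra.
Qed.

Lemma turnB_super w x y d : (d == (2, -1)) || (d == (1, 1)) ->
  mean d (turnB w) x y <= turnB w x y.
Proof.
have d0 := delta_gt0 R m; have d8 := delta_le8 R m.
have [b bE [b1 /andP[b0 ble1]]] := bV.
have w0 := basez_gt0 (- w).
have x0 := basez_gt0 (- (x + x)).
have ya := basez_gt0 y; have yb := basez_gt0 (- y).
move=> hd; rewrite /mean /turnB /ch.
have bb : b ^+ 2 * (1 + delta) ^+ 2 = 1 by rewrite -exprMn b1 expr1n.
pose Q := (1 + delta) ^+ 2.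
(* After multiplication by base ^ 2, the difference of the two sides is
   delta ^ 2 times a polynomial in delta whose coefficients are the three
   quantities assumed nonpositive and d1. *)
have coeff (d1 d2 : R) : 5 / 4 - 4 * d1 + 2 * d2 <= 0 ->
    5 / 4 - 6 * d1 + 3 * d2 <= 0 -> 4^-1 - 4 * d1 + d2 <= 0 -> 0 <= d1 ->
    (4^-1 + delta * d1) * (b * b) + (4^-1 - delta * d1) * ((1 + delta) * (1 + delta)) +
    (4^-1 + delta * d2) * (1 + delta) + (4^-1 - delta * d2) * b <= 1.
  move=> c2 c3 c4 c5.
  have Q0 : 0 < Q by rewrite exprn_gt0 //; lra.
  rewrite -(ler_pM2r Q0) mul1r -subr_ge0.
  have bQ : b * Q = 1 + delta by rewrite /Q expr2 mulrA b1 mul1r.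
  have bbQ : b * b * Q = 1 by rewrite -bb expr2.
  rewrite [X in 0 <= X](_ : _ = delta ^+ 2 *
    (- (5 / 4 - 4 * d1 + 2 * d2) - (5 / 4 - 6 * d1 + 3 * d2) * delta
     - (4^-1 - 4 * d1 + d2) * delta ^+ 2 + d1 * delta ^+ 3)).
    have e3 : 0 <= delta ^+ 3 by rewrite exprn_ge0 ?ltW.
    have e2 : 0 <= delta ^+ 2 by rewrite exprn_ge0 ?ltW.
    apply: mulr_ge0 => //; rewrite -!oppr_ge0 in c2 c3 c4.
    have t3 := mulr_ge0 c3 (ltW d0); have t4 := mulr_ge0 c4 e2.
    have t5 := mulr_ge0 c5 e3; rewrite mulNr in t3; rewrite mulNr in t4.
    by rewrite !addr_ge0.
  transitivity (Q - ((4^-1 + delta * d1) * (b * b * Q) +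
    (4^-1 - delta * d1) * ((1 + delta) * (1 + delta)) * Q +
    (4^-1 + delta * d2) * (1 + delta) * Q + (4^-1 - delta * d2) * (b * Q))).
    by ring.
  by rewrite bbQ bQ /Q; field.
have [c1 c2] : (4^-1 + delta * d.1%:~R) * (b * b) + (4^-1 - delta * d.1%:~R) *
      ((1 + delta) * (1 + delta)) +
    (4^-1 + delta * d.2%:~R) * (1 + delta) + (4^-1 - delta * d.2%:~R) * b <= 1 /\
  (4^-1 + delta * d.1%:~R) * (b * b) + (4^-1 - delta * d.1%:~R) *
      ((1 + delta) * (1 + delta)) +
    (4^-1 + delta * - d.2%:~R) * (1 + delta) + (4^-1 - delta * - d.2%:~R) * b <= 1.
  by split; apply: coeff; case/orP: hd => /eqP -> /=; rewrite ?rmorphN /=; lra.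
move: (d.1%:~R) (d.2%:~R) c1 c2 => d1 d2 c1 c2.
have u0 : 0 <= E (- x) * E (- x) * E (- w) by rewrite !mulr_ge0 // ltW // basez_gt0.
have H1 := ler_wpM2l (mulr_ge0 u0 (ltW ya)) c1.
have H2 := ler_wpM2l (mulr_ge0 u0 (ltW yb)) c2.
have := lerD H1 H2; rewrite !mulr1.
rewrite !opprD !opprK !basezD basez1 basezN1 bE.
move: (E y) (E (- y)) (E (- x)) (E (- w)) => p q X W H.
rewrite [leRHS](_ : _ = X * X * W * p + X * X * W * q); last by ring.
by apply: le_trans H; rewrite le_eqVlt; apply/orP; left; apply/eqP; ring.
Qed.

Lemma basez_super x y d : (d == (2, -1)) || (d == (1, 1)) ->
  mean d (fun x _ => E (- x)) x y <= E (- x).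
Proof.
have d0 := delta_gt0 R m; have d8 := delta_le8 R m.
have [b bE [b1 /andP[b0 ble1]]] := bV.
have x0 := basez_gt0 (- x).
move=> hd; rewrite /mean !opprD !opprK !basezD basez1 basezN1 bE.
have coeff (d1 : R) : 1 <= d1 ->
  (4^-1 + delta * d1) * b + (4^-1 - delta * d1) * (1 + delta) + 2^-1 <= 1.
  move=> h1; have B0 : 0 < 1 + delta by lra.
  rewrite -(ler_pM2r B0) mul1r -subr_ge0.
  rewrite [X in 0 <= X](_ : _ = delta ^+ 2 * (2 * d1 - 4^-1 + d1 * delta)).
    by rewrite mulr_ge0 ?exprn_ge0 ?ltW //; nra.
  transitivity ((1 + delta) - ((4^-1 + delta * d1) * (b * (1 + delta)) +
   (4^-1 - delta * d1) * (1 + delta) * (1 + delta) + 2^-1 * (1 + delta))).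
    by ring.
  by rewrite b1; field.
have : 1 <= d.1%:~R :> R by case/orP: hd => /eqP -> /=; lra.
move: (d.1%:~R) => d1 /coeff /(ler_wpM2l (ltW x0)) H.
apply: le_trans (_ : E (- x) * 1 <= _); last by rewrite mulr1.
by apply: le_trans H; rewrite -subr_ge0 [X in 0 <= X](_ : _ = 0) //; field.
Qed.

End supersolutions.

(** * The risk of leaving a chain of roads *)

(** Roads of even level are horizontal, those of odd level are vertical: [along]
    and [trans] are the coordinates along and across the roads of level [k]. *)
Definition along (k : nat) (u : Z2) : int := if odd k then u.2 else u.1.
Definition trans (k : nat) (u : Z2) : int := if odd k then u.1 else u.2.

Lemma alongS k u : along k.+1 u = trans k u.
Proof. by rewrite /along /trans /=; case: odd. Qed.

Lemma transS k u : trans k.+1 u = along k u.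
Proof. by rewrite /along /trans /=; case: odd. Qed.

Lemma along_trans_step k (u : Z2) (e : dir) :
  `|along k (u + val e) - along k u| + `|trans k (u + val e) - trans k u| = 1.
Proof.
have := valP e; rewrite !inE /along /trans.
by case: odd => /or4P[] /eqP -> /=; lia.
Qed.

Section road.
Variables (R : realType) (m : nat).
Variables (r w : nat -> nat) (c : nat -> int) (T : Z2 -> Z2).
Local Notation E z := ((base R m) ^ z).

Lemma sum_mean k (a b : int) (d u : Z2) (F : int -> int -> R) : small_drift d ->
  \sum_(e : dir) drift_law R m d e *
     F (along k (u + val e) - a) (trans k (u + val e) - b) =
  mean m (along k d, trans k d) F (along k u - a) (trans k u - b).
Proof.
move=> sd; pose G v := F (along k v - a) (trans k v - b).
rewrite (sum_drift_law m (fun e => G (u + e)) sd) /mean /G /along /trans.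
have P1 (z t : int) : z + 1 - t = z - t + 1 by rewrite addrAC.
have PN (z t : int) : z - 1 - t = z - t - 1 by rewrite addrAC.
by case: odd => /=; rewrite !(oppr0, addr0) !P1 !PN; ring.
Qed.

Hypothesis c0 : c 0%N = 0.
Hypothesis c_range : forall k, 2 * (r k.+1)%:Z <= c k.+1 <= (r k.+2)%:Z.
Hypothesis w_gt0 : forall k, (0 < w k)%N.
Hypothesis w_mono : forall k, (w k <= w k.+1)%N.
Hypothesis wr : forall k, (8 * w k <= r k)%N.
Hypothesis r_growth : forall k, (4 * r k <= r k.+1)%N.
Hypothesis cost : forall k, 2 ^+ (k + 6) * (r k.+2)%:R <= E (w k)%:Z.
Hypothesis T_road : forall k u,
  - (r k.+1)%:Z <= along k u < c k.+1 - (w k.+1)%:Z ->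
  `|trans k u - c k| <= (w k)%:Z ->
  (along k (T u), trans k (T u)) =
    if 0 < trans k u - c k then (2, -1) else (1, 1).

Let X k u : int := along k u - (c k.+1 - (w k.+1)%:Z).
Let Y k u : int := trans k u - c k.
Let wide k : int := (w k + 2 * w k.+1)%:Z.

Definition on_lane k u := [&& - (r k.+1)%:Z <= along k u, X k u < 0 & `|Y k u| <= (w k)%:Z].
(** The part of the next road between its edge and its center line, within the
    reach of a walk that arrives on the road of level [k]. *)
Definition on_turn k u := (0 <= X k u < (w k.+1)%:Z) && (`|Y k u| <= wide k).

(** An upper bound for the risk that remains when the walk enters the center of
    the road of level [k]. *)
Definition budget (k : nat) : R := (2 ^+ k.+1)^-1.

Let back k u : R := E (- (along k u + (r k.+1)%:Z)).
Let A k u : R := laneA R m (w k)%:Z (X k u) (Y k u) + back k u + budget k.+1.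
Let B k u : R := turnB R m (w k)%:Z (X k u) (Y k u) + back k u + budget k.+1.

Definition bound (u : Z2) : set R :=
  [set a | a = 1 \/ exists k, (on_lane k u /\ a = A k u) \/
     ((on_lane k u || on_turn k u) /\ a = B k u)].

(** An infimum of local supersolutions is superharmonic as soon as, at every
    neighbour of a point where one of the local formulas is in use, the infimum
    is below the value of that formula. This is what [risk_le_A] and [risk_le_B]
    are for. *)
Definition risk (u : Z2) : R := inf (bound u).

Lemma budget_gt0 k : 0 < budget k.
Proof. by rewrite invr_gt0 exprn_gt0. Qed.

Lemma ch_gt0 y : 0 < ch R m y.
Proof. by rewrite addr_gt0 // basez_gt0. Qed.

Lemma B_ge k u : back k u + budget k.+1 <= B k u.
Proof.
by rewrite /B -addrA lerDr /turnB ltW // !mulr_gt0 ?ch_gt0 ?basez_gt0.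
Qed.

Lemma A_ge k u : Y k u <= (w k)%:Z - X k u -> back k u + budget k.+1 <= A k u.
Proof.
move=> YX; rewrite /A -addrA lerDr /laneA mulr_ge0 ?(ltW (basez_gt0 _ _ _)) //.
apply: addr_ge0; first exact/ltW/ch_gt0.
by apply: mulr_ge0 => //; rewrite ler0z; move: YX; clear; lia.
Qed.

Lemma back_gt0 k u : 0 < back k u. Proof. exact: basez_gt0. Qed.

Lemma bound_ge0 u : lbound (bound u) 0.
Proof.
move=> a [->//|[k [[/and3P[_ Xl Yl] ->]|[_ ->]]]].
  apply: le_trans (A_ge _); first by apply: addr_ge0; apply: ltW; [exact: back_gt0|exact: budget_gt0].
  by lia.
apply: le_trans (B_ge _ _); by apply: addr_ge0; apply: ltW; [exact: back_gt0|exact: budget_gt0].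
Qed.

Lemma bound1 u : bound u 1. Proof. by left. Qed.

Lemma risk_ge0 u : 0 <= risk u.
Proof. by apply: lb_le_inf; [exists 1; exact: bound1|exact: bound_ge0]. Qed.

Lemma risk_le u a : bound u a -> risk u <= a.
Proof. by apply: ge_inf; exists 0; exact: bound_ge0. Qed.

Lemma risk_le1 u : risk u <= 1.
Proof. exact/risk_le/bound1. Qed.

Lemma basez_width k : E (- (w k)%:Z) * (r k.+2)%:R <= (2 ^+ (k + 6))^-1.
Proof.
rewrite -[E _]invr_expz; have := cost k; have := basez_gt0 R m (w k)%:Z.
move: (E (w k)%:Z) => e e0 h.
by rewrite mulrC ler_pdivrMr // mulrC ler_pdivlMr ?exprn_gt0 // mulrC.
Qed.

(** A walk that enters the road of level [k] on its center, far from its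
    beginning, spends at most half of [budget k] on this road; the other half
    is left for the higher levels. *)
Lemma risk_center k u : trans k u = c k ->
  - ((r k.+1)%:Z - (w k)%:Z) <= along k u <= (r k.+1)%:Z -> risk u <= budget k.
Proof.
move=> tu /andP[au1 au2].
have [cr1 cr2] := andP (c_range k).
have Y0 : Y k u = 0 by rewrite /Y tu subrr.
have wr1 := wr k.+1; have w1 := w_gt0 k.+1; have w01 := w_mono k; have w0 := w_gt0 k.
have rg := r_growth k.+1.
have Xl : X k u < 0 by rewrite /X; lia.
have ln : on_lane k u by rewrite /on_lane Xl Y0 normr0 andbT /=; lia.
have : risk u <= A k u by apply: risk_le; right; exists k; left.
move=> /le_trans; apply.
have eh := basez_width k.
have b1 : back k u <= E (- (w k)%:Z).
  by rewrite /back ler_eXz2l ?base_gt1 //; lia.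
have X2 : (w k)%:Z - X k u - 0 <= (3 * r k.+2)%:Z by rewrite /X; lia.
have e0 := basez_gt0 R m (- (w k)%:Z).
have r1 : 1 <= (r k.+2)%:R :> R by rewrite ler1n; have := wr k.+2; have := w_gt0 k.+2; lia.
have la : laneA R m (w k)%:Z (X k u) (Y k u) <= E (- (w k)%:Z) * (8 * (r k.+2)%:R).
  rewrite /laneA Y0 /ch oppr0 expr0z ler_wpM2l ?(ltW e0) //.
  have : ((w k)%:Z - X k u - 0)%:~R <= (3 * r k.+2)%:R :> R.
    by rewrite pmulrn ler_int.
  by rewrite natrM; lra.
have bk : back k u <= E (- (w k)%:Z) * (r k.+2)%:R.
  by apply: le_trans b1 _; rewrite ler_peMr // ltW.
have e6 : budget k = 2 * budget k.+1 /\ budget k.+1 = 16 * (2 ^+ (k + 6))^-1.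
  rewrite /budget exprD !exprS.
  have : 2 ^+ k != 0 :> R by rewrite expf_neq0.
  move: (2 ^+ k) => z z0; split; by field.
have [e61 e62] := e6; have := budget_gt0 k.
by rewrite /A; lra.
Qed.

Lemma ch_ge (y z : int) : z <= `|y| -> E z <= ch R m y.
Proof.
move=> zy; apply: (@le_trans _ _ (E `|y|)); first by rewrite ler_eXz2l ?base_gt1.
rewrite /ch; case: (ltP 0 y) => y0.
  by rewrite gtr0_norm // lerDl ltW // basez_gt0.
by rewrite ler0_norm // lerDr ltW // basez_gt0.
Qed.

Lemma turnB_ge1 (a x y : int) : a + x + x <= `|y| -> 1 <= turnB R m a x y.
Proof.
move=> h; rewrite /turnB.
apply: (@le_trans _ _ (E (- a) * (E (a + x + x) * E (- (x + x))))).
  rewrite -!basezD (_ : _ + _ = 0) ?expr0z //; lia.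
by rewrite ler_wpM2l ?(ltW (basez_gt0 _ _ _)) // ler_wpM2r ?(ltW (basez_gt0 _ _ _)) // ch_ge.
Qed.

(** The center of the next road is where the walk starts afresh. *)
Lemma on_turn_center k u : X k u = (w k.+1)%:Z -> `|Y k u| <= wide k ->
  risk u <= budget k.+1.
Proof.
move=> Xu Yu; apply: risk_center; first by rewrite transS; move: Xu; rewrite /X; lia.
rewrite alongS; move: Yu; rewrite /Y /wide.
have [ck0 ckr] : 0 <= c k /\ c k <= (r k.+1)%:Z.
  case: k {Xu} => [|k]; first by rewrite c0.
  by have /andP[] := c_range k; lia.
have := w_mono k; have := wr k.+1; have := r_growth k.+1; have := w_gt0 k.
by lia.
Qed.

(** The formula [B] exceeds 1 at the points off the roads, and on the center
    line of the next road it exceeds the budget that is left there. *)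
Lemma risk_le_B k v : X k v <= (w k.+1)%:Z -> risk v <= B k v.
Proof.
move=> Xv.
have big : (1 <= turnB R m (w k)%:Z (X k v) (Y k v) \/ 1 <= back k v) -> risk v <= B k v.
  have t0 : 0 < turnB R m (w k)%:Z (X k v) (Y k v).
    by rewrite /turnB !mulr_gt0 ?ch_gt0 ?basez_gt0.
  have bk := back_gt0 k v; have bu := budget_gt0 k.+1; have r1 := risk_le1 v.
  by rewrite /B; case=> h; lra.
have [X0|X0] := ltP (X k v) 0.
  have [Yw|Yw] := leP `|Y k v| (w k)%:Z; last by apply: big; left; apply: turnB_ge1; lia.
  have [al|al] := leP (- (r k.+1)%:Z) (along k v); last first.
    by apply: big; right; apply: basez_ge1; lia.
  by apply: risk_le; right; exists k; right; rewrite /on_lane al X0 Yw.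
have [Yw|Yw] := leP `|Y k v| (wide k); last first.
  by apply: big; left; apply: turnB_ge1; move: Yw; rewrite /wide; lia.
have [Xw|Xw] := ltP (X k v) (w k.+1)%:Z.
  by apply: risk_le; right; exists k; right; rewrite /on_turn X0 Xw Yw orbT.
have Xe : X k v = (w k.+1)%:Z by apply: le_anti; rewrite Xv Xw.
apply: (le_trans (on_turn_center Xe Yw)).
by apply: le_trans (B_ge _ _); rewrite lerDr ltW // back_gt0.
Qed.

(** At the end of the road, [X k v = 0], the formula [A] is not below [B], which
    takes over from there. *)
Lemma risk_le_A k v : X k v <= 0 ->
  `|Y k v| <= (if X k v < 0 then (w k)%:Z + 1 else (w k)%:Z) ->
  risk v <= A k v.
Proof.
move=> Xv Yv.
have la0 : 0 <= laneA R m (w k)%:Z (X k v) (Y k v).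
  rewrite /laneA mulr_ge0 ?(ltW (basez_gt0 _ _ _)) //.
  apply: addr_ge0; first exact/ltW/ch_gt0.
  by apply: mulr_ge0 => //; rewrite ler0z; move: Yv; case: ltP; lia.
have big : (1 <= laneA R m (w k)%:Z (X k v) (Y k v) \/ 1 <= back k v) -> risk v <= A k v.
  have bk := back_gt0 k v; have bu := budget_gt0 k.+1; have r1 := risk_le1 v.
  by rewrite /A; case=> h; lra.
move: Yv; have [X0|X0] := ltP (X k v) 0 => Yv; last first.
  have X0' : X k v = 0 by lia.
  apply: le_trans (risk_le_B (k := k) _) _; first by lia.
  rewrite /A /B !lerD2r /laneA /turnB X0' addr0 oppr0 expr0z mulr1 subr0.
  rewrite ler_wpM2l ?(ltW (basez_gt0 _ _ _)) // lerDl mulr_ge0 // ler0z.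
  by move: Yv; lia.
have [Yw|Yw] := leP `|Y k v| (w k)%:Z; last first.
  apply: big; left; rewrite /laneA.
  apply: (@le_trans _ _ (E (- (w k)%:Z) * E (w k)%:Z)).
    by rewrite -basezD addNr expr0z.
  rewrite ler_wpM2l ?(ltW (basez_gt0 _ _ _)) //.
  apply: (@le_trans _ _ (ch R m (Y k v))); first by apply: ch_ge; lia.
  by rewrite lerDl mulr_ge0 // ler0z; lia.
have [al|al] := leP (- (r k.+1)%:Z) (along k v); last first.
  by apply: big; right; apply: basez_ge1; lia.
by apply: risk_le; right; exists k; left; rewrite /on_lane al X0 Yw.
Qed.

Lemma lane_drift k u : on_lane k u ->
  (along k (T u), trans k (T u)) = if 0 < Y k u then (2, -1) else (1, 1).
Proof.
by move=> /and3P[h1 h2 h3]; apply: T_road => //; rewrite h1 /=; move: h2; rewrite /X; lia.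
Qed.

(** The left half of the next road has the drift (1,1), which is why the turn
    does not have to be treated separately in the definition of the roads. *)
Lemma turn_drift k u : on_turn k u -> (along k (T u), trans k (T u)) = (1, 1).
Proof.
move=> /andP[/andP[X0 Xw] Yw].
have Y1 : along k u - c k.+1 < 0 by move: Xw; rewrite /X; lia.
have := T_road (k := k.+1) (u := u).
rewrite alongS transS.
have [ck0 ckr] : 0 <= c k /\ c k <= (r k.+1)%:Z.
  case: k {X0 Xw Yw Y1} => [|k]; first by rewrite c0.
  by have /andP[] := c_range k; lia.
have Yk : `|trans k u - c k| <= wide k by [].
have h1 : - (r k.+2)%:Z <= trans k u < c k.+2 - (w k.+2)%:Z.
  move: Yk; rewrite /wide; have /andP[] := c_range k.+1.
  have := w_mono k; have := wr k.+1; have := wr k.+2; have := r_growth k.+1; have := w_gt0 k.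
  have := w_gt0 k.+2; lia.
have h2 : `|along k u - c k.+1| <= (w k.+1)%:Z by move: X0 Xw; rewrite /X; lia.
by move=> /(_ h1 h2); rewrite alongS transS ltNge ltW //= => -[-> ->].
Qed.

Lemma drift_cases k u : on_lane k u || on_turn k u ->
  ((along k (T u), trans k (T u)) == (2, -1)) ||
  ((along k (T u), trans k (T u)) == (1, 1)).
Proof.
move=> /orP[/lane_drift ->|/turn_drift ->]; last by rewrite eqxx orbT.
by case: ifP; rewrite eqxx ?orbT.
Qed.

Lemma drift_small k u : on_lane k u || on_turn k u -> small_drift (T u).
Proof.
move=> /drift_cases; rewrite /small_drift /along /trans.
by case: (T u) => a b /=; case: odd => /orP[] /eqP [-> ->].
Qed.

Lemma sum_bound k u (F : int -> int -> R) (q : R) :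
  on_lane k u || on_turn k u ->
  mean m (along k (T u), trans k (T u)) F (X k u) (Y k u) <= F (X k u) (Y k u) ->
  (forall e : dir, risk (u + val e) <=
     F (X k (u + val e)) (Y k (u + val e)) + back k (u + val e) + q) ->
  \sum_(e : dir) drift_law R m (T u) e * risk (u + val e) <=
    F (X k u) (Y k u) + back k u + q.
Proof.
move=> on FX H; have sd := drift_small on.
pose G x y := F x y + (E (- (x + ((r k.+1)%:Z + (c k.+1 - (w k.+1)%:Z)))) + q).
have GE v : G (X k v) (Y k v) = F (X k v) (Y k v) + back k v + q.
  by rewrite /G /back addrA; congr (_ + E _ + _); rewrite /X; lia.
apply: (@le_trans _ _ (\sum_(e : dir) drift_law R m (T u) e *
    G (X k (u + val e)) (Y k (u + val e)))).
  apply: ler_sum => e _; apply: ler_wpM2l; last by rewrite GE.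
  by have /andP[/forallP/(_ e)/andP[]] := weightP (drift_law R m (T u)).
rewrite (sum_mean k _ _ _ G) // -GE /G meanD lerD // meanD mean_cst lerD2r.
set a := _ + (c _ - _).
have aE x : E (- (x + a)) = E (- x) * E (- a) by rewrite opprD basezD.
have := @basez_super R m (X k u) (Y k u) _ (drift_cases on).
move=> /(ler_wpM2r (ltW (basez_gt0 R m (- a)))).
by rewrite -aE; apply: le_trans; rewrite /mean !aE le_eqVlt; apply/orP; left; apply/eqP; ring.
Qed.

Lemma risk_super u :
  \sum_(e : dir) drift_law R m (T u) e * risk (u + val e) <= risk u.
Proof.
have [wpos wsum] : (forall e, 0 <= drift_law R m (T u) e) /\
    \sum_(e : dir) drift_law R m (T u) e = 1.
  have /andP[/forallP h /eqP ->] := weightP (drift_law R m (T u)).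
  by split=> // e; have /andP[] := h e.
apply: lb_le_inf; first by exists 1; exact: bound1.
move=> a [->|[k [[ln ->]|[lt ->]]]].
- rewrite -wsum; apply: ler_sum => e _.
  by rewrite -[leRHS]mulr1; apply: ler_wpM2l => //; exact: risk_le1.
- have on : on_lane k u || on_turn k u by rewrite ln.
  apply: (sum_bound (F := laneA R m (w k)%:Z)) => //.
    apply: laneA_super; rewrite lane_drift //.
    by case: ltP => Y0 /=; rewrite ?eqxx ?orbT // leNgt.
  move=> e; have := along_trans_step k u e; case/and3P: ln => _ X0 Y0 st.
  apply: risk_le_A; first by move: X0 st; rewrite /X; lia.
  by case: ltP => h; move: h X0 Y0 st; rewrite /X /Y; clear; lia.
- apply: (sum_bound (F := turnB R m (w k)%:Z)) => //.
    exact/turnB_super/drift_cases.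
  move=> e; have := along_trans_step k u e => st.
  apply: risk_le_B; have := w_gt0 k.+1; move: lt st; rewrite /on_lane /on_turn /X.
  by move=> /orP[/and3P[_ X0 _]|/andP[/andP[_ X0] _]]; lia.
Qed.

Lemma risk_drift u : risk u < 1 -> small_drift (T u) /\ 1 <= dotZ2 (T u) ones.
Proof.
move=> ru.
have [k on] : exists k, on_lane k u || on_turn k u.
  apply: contrapT => /forallNP H; suff : 1 <= risk u by rewrite leNgt ru.
  apply: lb_le_inf; first by exists 1; exact: bound1.
  move=> a [->//|[k [[ln _]|[lt _]]]]; last by case: (H k).
  by case: (H k); rewrite ln.
split; first exact: drift_small on.
move: (drift_cases on); rewrite /dotZ2 /along /trans.
by case: (T u) => a b /=; case: odd => /orP[] /eqP [-> ->].
Qed.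

End road.

(** Walks to infinity in the direction (-1,-1) are the reflections of walks in
    the direction (1,1). *)
Definition reflect (b : bool) (u : Z2) : Z2 := if b then - u else u.

Lemma reflectK b : involutive (reflect b).
Proof. by case: b => u //=; rewrite opprK. Qed.

Lemma reflectD b u v : reflect b (u + v) = reflect b u + reflect b v.
Proof. by case: b => //=; rewrite opprD. Qed.

Lemma dot_onesD u v : dotZ2 (u + v) ones = dotZ2 u ones + dotZ2 v ones.
Proof. by rewrite /dotZ2 /= !mulr1; ring. Qed.

Lemma sum_reflect (R : realType) m b (d : Z2) (F : Z2 -> R) :
  \sum_(e : dir) drift_law R m d e * F (reflect b (val e)) =
  \sum_(e : dir) drift_law R m (reflect b d) e * F (val e).
Proof.
case: b => //=; pose q (d x : Z2) := if small_drift d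
  then 4^-1 + delta R m * (dotZ2 d x)%:~R else 4^-1.
have q1 d' G : \sum_(e : dir) drift_law R m d' e * G (val e) =
    \sum_(e : dir) (fun x => q d' x * G x) (val e).
  by apply: eq_bigr => e _; rewrite /= ffunE.
rewrite (q1 d (fun x => F (- x))) (q1 (- d) F).
rewrite (sum_dir (fun x => q d x * F (- x))) (sum_dir (fun x => q (- d) x * F x)).
rewrite /q !opprK.
rewrite (_ : small_drift (- d) = small_drift d); last first.
  by rewrite /small_drift /= !normrN.
have dN x y : dotZ2 (- x) y = - dotZ2 x y by rewrite /dotZ2 /=; ring.
have dN' x y : dotZ2 x (- y) = - dotZ2 x y by rewrite /dotZ2 /=; ring.
by case: ifP => _; rewrite ?dN ?dN' ?dN ?opprK; ring.
Qed.

Section road_escape.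
Variables (R : realType) (m : nat) (r w : nat -> nat).

Definition scales : Prop :=
  [/\ forall k, (0 < w k)%N, forall k, (w k <= w k.+1)%N,
      forall k, (8 * w k <= r k)%N, forall k, (4 * r k <= r k.+1)%N
    & forall k, 2 ^+ (k + 6) * (r k.+2)%:R <= (base R m) ^ (w k)%:Z].

(** A chain of roads with center lines [c k]: each road is intact, up to
    half-width [w k], from coordinate [- r k.+1] to the edge of the next road.
    The walk passes from one to the next at distances between [2 * r k.+1] and
    [r k.+2] from the origin. *)
Definition road (c : nat -> int) (T : Z2 -> Z2) : Prop :=
  [/\ c 0%N = 0, forall k, 2 * (r k.+1)%:Z <= c k.+1 <= (r k.+2)%:Z
    & forall k u, - (r k.+1)%:Z <= along k u < c k.+1 - (w k.+1)%:Z ->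
        `|trans k u - c k| <= (w k)%:Z ->
        (along k (T u), trans k (T u)) =
          if 0 < trans k u - c k then (2, -1) else (1, 1)].

(** Writing [base] as [1 + delta], the drift lowers the mean of
    [base ^ (- dot)] by [2 * delta ^ 2] or more up to terms of higher order,
    while the convexity of [base ^ z] raises it by [delta ^ 2 / 2] only. *)
Lemma drift_super (d : Z2) : small_drift d -> 1 <= dotZ2 d ones ->
  \sum_(e : dir) drift_law R m d e * base R m ^ (- dotZ2 (val e) ones) <=
  1 - delta R m ^+ 2.
Proof.
move=> sd d1; rewrite (sum_drift_law m (fun x => base R m ^ (- dotZ2 x ones)) sd).
rewrite /dotZ2 /= !(mulr1, addr0, add0r, oppr0, opprK) expr1z.
have -> : base R m ^ (-1) = (base R m)^-1 by [].
have d0 := delta_gt0 R m; have d8 := delta_le8 R m.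
have b0 := base_gt0 R m; rewrite -(ler_pM2r b0).
have : 1 <= d.1%:~R + d.2%:~R :> R.
  by rewrite -intrD -(ler_int R) in d1 *; move: d1; rewrite /dotZ2 /= !mulr1.
move: (d.1%:~R) (d.2%:~R) => p q pq; rewrite -subr_ge0.
rewrite [X in 0 <= X](_ : _ = delta R m ^+ 2 * (2 * (p + q) - 3 / 2 +
  delta R m * (p + q) - delta R m)).
  by apply: mulr_ge0; rewrite ?exprn_ge0 ?ltW //; nra.
rewrite /base; field.
by rewrite gt_eqF // -/(base R m).
Qed.

Lemma road_escape b c (T : Z2 -> Z2) (mu : probability path_space R) :
  scales -> road c (fun u => reflect b (T (reflect b u))) ->
  walk_law (fun u => drift_law R m (T u)) 0 mu ->
  2^-1 <= pr mu (drifts (fun u => dotZ2 (reflect b u) ones)).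
Proof.
move=> [w0 ww wr rr cost] [c0 cr Tr] law.
pose T' u := reflect b (T (reflect b u)).
pose h u := risk R m r w c (reflect b u).
have rs := @risk_super R m r w c T' c0 cr w0 ww wr rr cost Tr.
have rd := @risk_drift R m r w c T' c0 cr w0 ww wr rr Tr.
have hs u : \sum_(e : dir) drift_law R m (T u) e * h (u + val e) <= h u.
  rewrite /h; under eq_bigr do rewrite reflectD.
  rewrite (sum_reflect m b (T u) (fun x => risk R m r w c (reflect b u + x))).
  by have := rs (reflect b u); rewrite /T' reflectK.
have d0 := delta_gt0 R m; have d8 := delta_le8 R m.
have rho01 : 0 <= 1 - delta R m ^+ 2 < 1 by apply/andP; split; nra.
have h0 : h 0 <= 2^-1.
  rewrite /h (_ : reflect b 0 = 0); last by case: (b); rewrite /= ?oppr0.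
  have -> : 2^-1 = budget R 0 by rewrite /budget expr1.
  apply: risk_center => //.
  by have := wr 1%N; have := ww 0%N; rewrite /along /=; lia.
apply: le_trans (escape law (h := h) (b := base R m) (rho := 1 - delta R m ^+ 2)
   _ _ _ (base_gt1 R m) rho01 _).
- by lra.
- by move=> u; exact: risk_ge0.
- by move=> u _; exact: hs.
- by move=> u e; rewrite reflectD dot_onesD.
move=> u hu; have [sd d1] := rd _ hu.
rewrite (sum_reflect m b (T u) (fun x => base R m ^ (- dotZ2 x ones))).
by move: sd d1; rewrite /T' reflectK; exact: drift_super.
Qed.

End road_escape.

(** * Roads laid out from marks *)

(** The inverse of the pair of coordinates [along k], [trans k]. *)
Definition place (k : nat) (a t : int) : Z2 := if odd k then (t, a) else (a, t).

Lemma along_place k a t : along k (place k a t) = a.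
Proof. by rewrite /along /place; case: odd. Qed.

Lemma trans_place k a t : trans k (place k a t) = t.
Proof. by rewrite /trans /place; case: odd. Qed.

Lemma place_eq k u v : along k u = along k v -> trans k u = trans k v -> u = v.
Proof.
by rewrite /along /trans; case: u v => [? ?] [? ?]; case: odd => /= -> ->.
Qed.

Lemma alongB k u v : along k (u - v) = along k u - along k v.
Proof. by rewrite /along; case: odd. Qed.

Lemma transB k u v : trans k (u - v) = trans k u - trans k v.
Proof. by rewrite /trans; case: odd. Qed.

(** The drift on a cross-section of a pair of roads of half-width [a], in the
    coordinates along and across the roads; [j] is the offset from the center
    line of the first road, and the second road is centered at [2 * a + 1]. *)
Definition profile (a j : int) : Z2 :=
  if - a <= j <= 0 then (1, 1) else if 0 < j <= a then (2, -1)
  else if a < j <= a + a then (-2, 1)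
  else if a + a < j <= a + a + a + 1 then (-1, -1) else 0.

Lemma profile_support a j : profile a j != 0 -> - a <= j <= a + a + a + 1.
Proof.
rewrite /profile; case: ifP => [? _|_]; first by lia.
case: ifP => [? _|_]; first by lia.
case: ifP => [? _|_]; first by lia.
by case: ifP => [? _|_]; [lia|rewrite eqxx].
Qed.

(** The two roads of a pair are exchanged by the place reflection that
    reverses their directions. *)
Lemma profile_flip a j : 0 < a -> profile a (a + a + 1 - j) = - profile a j.
Proof.
move=> a0; rewrite /profile.
rewrite (_ : (- a <= a + a + 1 - j <= 0) = (a + a < j <= a + a + a + 1)); last by lia.
rewrite (_ : (0 < a + a + 1 - j <= a) = (a < j <= a + a)); last by lia.
rewrite (_ : (a < a + a + 1 - j <= a + a) = (0 < j <= a)); last by lia.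
rewrite (_ : (a + a < a + a + 1 - j <= a + a + a + 1) = (- a <= j <= 0)); last by lia.
case: ifP => h1; first by rewrite !ifF //; apply/negbTE; lia.
case: ifP => h2; first by rewrite !ifF //; apply/negbTE; lia.
case: ifP => h3; first by rewrite ifF //; apply/negbTE; lia.
by case: ifP => h4; rewrite ?oppr0.
Qed.

Section layout.
Variables (r w M : nat -> nat).

Definition lane (k : nat) (d : Z2) : Z2 :=
  if 0 <= along k d < (M k)%:Z
  then let v := profile (w k)%:Z (trans k d) in place k v.1 v.2 else 0.

Lemma place0 k : place k 0 0 = 0.
Proof. by rewrite /place; case: odd. Qed.

Lemma lane_support k d : lane k d != 0 ->
  0 <= along k d < (M k)%:Z /\ - (w k)%:Z <= trans k d <= (3 * w k + 1)%:Z.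
Proof.
rewrite /lane; case: ifP => [ad|_]; last by rewrite eqxx.
move=> h; split=> //; have /profile_support : profile (w k) (trans k d) != 0.
  by apply: contra_neq h => ->; exact: place0.
by lia.
Qed.

Definition corner k : Z2 := place k ((M k)%:Z - 1) (2 * w k + 1)%:Z.

Lemma lane_flip k d : (0 < w k)%N -> lane k (corner k - d) = - lane k d.
Proof.
move=> w0; rewrite /lane alongB transB along_place trans_place.
rewrite (_ : (0 <= _ < _) = (0 <= along k d < (M k)%:Z)); last by lia.
case: ifP => _; last by rewrite oppr0.
rewrite (_ : _ - trans k d = (w k)%:Z + (w k)%:Z + 1 - trans k d); last by lia.
by rewrite profile_flip //; case: profile => a b; rewrite /place; case: odd.
Qed.

(** What the proof uses of the way in which overlapping roads are resolved: a
    mark decides at points that are covered by no other mark of its level and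
    by no mark of higher level. *)
Definition obeys (mk : nat -> Z2 -> bool) (T : Z2 -> Z2) : Prop :=
  forall k z u, mk k z -> lane k (u - z) != 0 ->
    (forall z', mk k z' -> lane k (u - z') != 0 -> z' = z) ->
    (forall k' z', (k < k')%N -> mk k' z' -> lane k' (u - z') = 0) ->
    T u = lane k (u - z).

(** The point reflection of the roads laid out by a mark consists of the roads
    laid out by another mark, because the two roads of a pair are exchanged. *)
Definition flip (k : nat) (z : Z2) : Z2 := - z - corner k.

Lemma flipK k : involutive (flip k).
Proof. by move=> z; rewrite /flip opprB opprK addrAC subrr add0r. Qed.

Lemma obeys_flip mk T : (forall k, 0 < w k)%N -> obeys mk T ->
  obeys (fun k z => mk k (flip k z)) (fun u => - T (- u)).
Proof.
move=> w0 ob k z u mz lz uz hz.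
have lf k' z' : lane k' (- u - flip k' z') = - lane k' (u - z').
  rewrite -lane_flip //; congr lane; rewrite /flip !opprB opprK.
  by rewrite [LHS]addrC addrA.
rewrite (ob k (flip k z) (- u)) //.
- by rewrite lf opprK.
- by rewrite lf oppr_eq0.
- move=> z' mz' lz'; rewrite -[z'](flipK k); congr flip; apply: uz.
    by rewrite flipK.
  by move: lz'; rewrite -{1}[z'](flipK k) lf oppr_eq0.
move=> k' z' kk' mz'; apply/eqP; rewrite -[z'](flipK k') lf oppr_eq0.
by apply/eqP/hz => //; rewrite flipK.
Qed.

(** The roads laid out by [z] cross the whole box of radius [r k.+2], if they
    touch it at all. *)
Definition spans (k : nat) (z : Z2) : Prop :=
  along k z < - (r k.+2)%:Z /\ (r k.+2)%:Z < along k z + (M k)%:Z.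

Definition no_ends k (mk : Z2 -> bool) : Prop := forall z, mk z ->
  `|trans k z| <= (2 * r k.+2)%:Z ->
  ~ (`|along k z| <= (r k.+2)%:Z \/ `|along k z + (M k)%:Z| <= (r k.+2)%:Z).

Definition no_near k (mk : Z2 -> bool) : Prop := forall z, mk z ->
  spans k z -> (2 * r k)%:Z < `|trans k z|.

Definition no_close k (mk : Z2 -> bool) : Prop := forall z z', mk z -> mk z' ->
  spans k z -> spans k z' -> `|trans k z| <= (2 * r k.+1)%:Z ->
  `|trans k z - trans k z'| <= (4 * w k + 1)%:Z -> z = z'.

Definition some_ahead k (mk : Z2 -> bool) : Prop := exists z, [/\ mk z, spans k z
  & (2 * r k)%:Z < trans k z <= (r k.+1)%:Z].

(** Seen from the box of radius [r k.+2], the roads of level [k] are full lines;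
    they avoid the box of radius [r k], are disjoint in the box of radius
    [r k.+1], and one of them is available there on the positive side. *)
Definition good_level k (mk : Z2 -> bool) : Prop :=
  [/\ no_ends k mk, no_near k mk, no_close k mk & some_ahead k mk].

(** A position of the mark of level 0 for which the origin lies on the center
    of the first road, well inside of it. *)
Definition start : Z2 := (- (r 2 + 1)%:Z, 0).

Definition good_start (mk : Z2 -> bool) : Prop := mk start /\
  forall z, mk z -> `|z.2| <= (2 * r 2)%:Z ->
    `|z.1| <= (r 2 + M 0)%:Z -> z = start.

Hypothesis w_gt0 : forall k, (0 < w k)%N.
Hypothesis wr : forall k, (8 * w k <= r k)%N.
Hypothesis r_growth : forall k, (4 * r k <= r k.+1)%N.
Hypothesis M_big : (3 * r 2 < M 0)%N.

Lemma touch_spans k mk z u : no_ends k mk -> mk z -> lane k (u - z) != 0 ->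
  `|along k u| <= (r k.+2)%:Z -> `|trans k u| <= (r k.+2)%:Z ->
  spans k z /\ - (w k)%:Z <= trans k u - trans k z <= (3 * w k + 1)%:Z.
Proof.
move=> ne mz /lane_support; rewrite alongB transB => -[az tz] au tu.
split=> //; have w0 := w_gt0 k; have wr2 := wr k.
have rg1 := r_growth k; have rg2 := r_growth k.+1.
have tz2 : `|trans k z| <= (2 * r k.+2)%:Z by lia.
have /not_orP[/negP h1 /negP h2] := ne _ mz tz2.
by split; lia.
Qed.

Lemma r_mono j k : (j <= k)%N -> (r j <= r k)%N.
Proof.
move=> /subnK <-; elim: (k - j)%N => [|i IH] //.
by rewrite addSn; have := r_growth (i + j); lia.
Qed.

Lemma first_ahead k mk : some_ahead k mk -> exists z, [/\ mk z, spans k z,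
  0 < trans k z <= (r k.+1)%:Z &
  forall z', mk z' -> spans k z' -> 0 < trans k z' -> trans k z <= trans k z'].
Proof.
move=> [z0 [m0 s0 t0]].
pose Q (n : nat) := `[< exists z, [/\ mk z, spans k z, trans k z = n%:Z & 0 < trans k z] >].
have exQ : exists n, Q n.
  exists (absz (trans k z0)); apply/asboolP; exists z0; split=> //; lia.
have [n /asboolP[z [mz sz tz tz0]] nmin] := ex_minnP exQ.
have zmin z' : mk z' -> spans k z' -> 0 < trans k z' -> trans k z <= trans k z'.
  move=> mz' sz' tz'; have : Q (absz (trans k z')).
    by apply/asboolP; exists z'; split=> //; lia.
  by move=> /nmin; lia.
exists z; split=> //; rewrite tz0 /=.
by have := zmin _ m0 s0; lia.
Qed.

(** The road of level [k+1] in the chain is the first one on the positive side.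
    It starts on the road of level [k], which is intact up to there: other
    roads of level [k] and roads of higher levels are too far away, and no other
    road of level [k+1] is in between. *)
Lemma good_road mk T : obeys mk T -> good_start (mk 0%N) ->
  (forall k, good_level k.+1 (mk k.+1)) -> exists c, road r w c T.
Proof.
move=> ob [m0 u0] good.
have [zc zcP] := choice (fun k => first_ahead (let: And4 _ _ _ h := good k in h)).
pose z k := if k is k'.+1 then zc k' else start.
pose c k := trans k (z k); exists c.
have c0 : c 0%N = 0 by [].
have spans0 : spans 0%N start.
  by rewrite /spans /along /start /=; have := wr 2; have := w_gt0 2; lia.
have zs k : spans k (z k) by case: k => // k; have [] := zcP k.
have mzk k : mk k (z k) by case: k => // k; have [] := zcP k.
have ck1 k : 0 < c k.+1 <= (r k.+2)%:Z by have [_ _ ? _] := zcP k.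
have ck k : 0 <= c k <= (r k.+1)%:Z.
  by case: k => [|k]; [rewrite c0|have := ck1 k; lia].
have near k : (2 * r k.+1)%:Z < c k.+1.
  have [_ nn _ _] := good k; have := nn _ (mzk k.+1) (zs k.+1).
  by rewrite -/(c k.+1); have := ck1 k; lia.
split=> //; first by move=> k; have := ck1 k; have := near k; lia.
move=> k u au tu; rewrite -/(c k).
have w0 := w_gt0 k; have wk := wr k; have wk1 := wr k.+1; have w01 := w_gt0 k.+1.
have rg := r_growth k; have rg1 := r_growth k.+1; have rg2 := r_growth k.+2.
have ckk := ck k; have ckk1 := ck1 k.
have [sz1 sz2] := zs k.
have bu : `|along k u| <= (r k.+2)%:Z /\ `|trans k u| <= (r k.+1 + w k)%:Z by lia.
have [bu1 bu2] := bu.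
have zt : trans k (z k) = c k by [].
have lz : lane k (u - z k) = let v := (if 0 < trans k u - c k then (2, -1) else (1, 1) : Z2)
    in place k v.1 v.2.
  rewrite /lane alongB transB zt ifT; last by lia.
  rewrite /profile; case: (ltP 0 (trans k u - c k)) => h.
    by rewrite ifF ?ifT //; [lia|apply/negbTE; lia].
  by rewrite ifT //; lia.
have -> : T u = lane k (u - z k).
  apply: ob => //.
  - rewrite lz; apply/eqP => /(congr1 (along k)).
    by rewrite along_place; case: ifP => _ /=; rewrite /along; case: odd.
  - move=> z' mz' lz'.
    case: k au tu w0 wk wk1 w01 rg rg1 rg2 ckk ckk1 sz1 sz2 bu bu1 bu2 zt lz mz' lz'
       => [|k] au tu w0 wk wk1 w01 rg rg1 rg2 ckk ckk1 sz1 sz2 bu bu1 bu2 zt lz mz' lz'.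
      have [] := lane_support lz'; rewrite alongB transB => h1 h2.
      apply: u0 => //; move: h1 h2 bu1 bu2; rewrite /along /trans /=; lia.
    have [ne _ nc _] := good k.
    have [||s' t'] := touch_spans ne mz' lz'; [by lia..|].
    by apply/esym; apply: (nc _ _ (mzk k.+1) mz' (zs k.+1) s'); lia.
  - move=> k' z' kk' mz'; apply/eqP; apply/negPn/negP => lz'.
    case: k' kk' mz' lz' => // k' kk' mz' lz'.
    have [ne nn _ _] := good k'.
    have rm : (r k.+2 <= r k'.+3)%N by apply: r_mono; lia.
    have [||s' t'] := touch_spans ne mz' lz'.
    + by move: bu1 bu2; rewrite /along /trans; case: (odd k); case: odd; lia.
    + by move: bu1 bu2; rewrite /along /trans; case: (odd k); case: odd; lia.
    have far := nn _ mz' s'; have wk' := wr k'.+1; have w0' := w_gt0 k'.+1.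
    move: kk'; rewrite ltnS leq_eqVlt => /orP[/eqP ek|kk'].
      subst k'; have [_ _ _ zmin] := zcP k.
      have h : 0 < along k z' -> c k.+1 <= along k z'.
        by rewrite -transS; exact: zmin.
      by rewrite !transS in far t'; lia.
    have rm' : (r k.+2 <= r k'.+1)%N by apply: r_mono; lia.
    by move: bu1 bu2 far t'; rewrite /along /trans; case: (odd k); case: odd; lia.
rewrite lz along_place trans_place.
by case: ifP.
Qed.

End layout.

(** * The random environment *)

(** The coins [(k, z, i)], for all [i], decide whether there is a mark of level
    [k] at [z]. *)
Definition site : Type := (nat * Z2 * nat)%type.
HB.instance Definition _ := Countable.on site.

Definition translate_site (v : Z2) (s : site) : site := (s.1.1, s.1.2 + v, s.2).

Lemma translate_site_inj v : injective (translate_site v).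
Proof. move=> [[k z] i] [[k' z'] i'] E.
have -> : k = k' := congr1 (fun s : site => s.1.1) E.
have -> : i = i' := congr1 (fun s : site => s.2) E.
by have -> : z = z' := addIr v (congr1 (fun s : site => s.1.2) E). Qed.

Lemma mulrn_Z2_eq0 (v : Z2) n : (0 < n)%N -> v *+ n = 0 -> v = 0.
Proof.
move=> n0 vn; have [vn1 vn2] : (v *+ n).1 = v.1 *+ n /\ (v *+ n).2 = v.2 *+ n.
  elim: n {n0 vn} => [|n [IH1 IH2]]; first by rewrite !mulr0n.
  by rewrite !mulrS /= IH1 IH2.
move: vn1 vn2; rewrite vn /= => /esym/eqP + /esym/eqP.
rewrite !mulrn_eq0 eqn0Ngt n0 /=.
by case: v {vn} => a b /= /eqP -> /eqP ->.
Qed.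

Section environment.
Variables (pexp w M : nat -> nat).
Local Notation lane := (lane w M).

Definition mark (y : coins site) (k : nat) (z : Z2) : bool :=
  all (fun i => y (k, z, i)) (iota 0 (pexp k)).

Definition shape (k : nat) : seq Z2 :=
  [seq place k a%:Z (j%:Z - (w k)%:Z) | a <- iota 0 (M k), j <- iota 0 (4 * w k + 2)].

Lemma shapeP k d : lane k d != 0 -> d \in shape k.
Proof.
move=> /lane_support[ad td].
have -> : d = place k (absz (along k d))%:Z
    ((absz (trans k d + (w k)%:Z))%:Z - (w k)%:Z).
  by apply: (place_eq (k := k)); rewrite ?along_place ?trans_place; lia.
by apply: allpairs_f; rewrite mem_iota; lia.
Qed.

(** Among the marks of level [k] that cover [u], the choice of one by its
    displacement from [u] commutes with translations. *)
Definition layer (y : coins site) (k : nat) (u : Z2) : Z2 :=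
  head 0 [seq lane k d | d <- shape k & mark y k (u - d) && (lane k d != 0)].

Fixpoint upto (y : coins site) (u : Z2) (K : nat) : Z2 :=
  if K is k.+1 then if layer y k u != 0 then layer y k u else upto y u k else 0.

Definition quiet (y : coins site) (u : Z2) (K : nat) : Prop :=
  forall k, (K <= k)%N -> layer y k u = 0.

(** The drift given by the highest level that covers [u]. If infinitely many
    levels do, [xget] returns the default 0 and the drift is 0. *)
Definition drift (y : coins site) (u : Z2) : Z2 := upto y u (xget 0%N (quiet y u)).

Lemma layer0 y k u : (forall z, mark y k z -> lane k (u - z) = 0) -> layer y k u = 0.
Proof.
move=> H; rewrite /layer (@eq_in_filter _ _ pred0) ?filter_pred0 // => d _ /=.
apply/negP => /andP[/H]; rewrite opprB addrC subrK => ->; by rewrite eqxx.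
Qed.

Lemma layer_unique y k u z : mark y k z -> lane k (u - z) != 0 ->
  (forall z', mark y k z' -> lane k (u - z') != 0 -> z' = z) ->
  layer y k u = lane k (u - z).
Proof.
move=> mz lz uz; rewrite /layer; set s := [seq d <- shape k | _].
have us : u - z \in s by rewrite mem_filter lz (shapeP lz) opprB addrC subrK mz.
have : forall d, d \in s -> lane k d = lane k (u - z).
  move=> d; rewrite mem_filter => /andP[/andP[md ld] _].
  rewrite -(uz (u - d)) //; first by rewrite opprB addrC subrK.
  by rewrite opprB addrC subrK.
case: s us => //= d s _; apply; exact: mem_head.
Qed.

Lemma upto_stable y u K n : quiet y u K -> upto y u (K + n) = upto y u K.
Proof.
by move=> q; elim: n => [|n IH]; rewrite ?addn0 // addnS /= q ?leq_addr // eqxx.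
Qed.

Lemma drift_quiet y u K : quiet y u K -> drift y u = upto y u K.
Proof.
move=> q; have := @xgetPex _ 0%N (quiet y u) (ex_intro _ K q).
rewrite /drift; set K' := xget _ _ => q'.
have [KK|KK] := leqP K K'; first by rewrite -(subnKC KK) upto_stable.
by rewrite -(subnKC (ltnW KK)) upto_stable.
Qed.

Lemma drift_obeys y : obeys w M (mark y) (drift y).
Proof.
move=> k z u mz lz uz hz.
have q : quiet y u k.+1.
  by move=> k' kk'; apply: layer0 => z' mz'; exact: hz.
by rewrite (drift_quiet q) /= (layer_unique mz lz uz) lz.
Qed.

Lemma mark_translate y v k z :
  mark (y \o translate_site v) k z = mark y k (z + v).
Proof. by []. Qed.

Lemma layer_translate y v k u :
  layer (y \o translate_site v) k u = layer y k (u + v).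
Proof.
rewrite /layer; congr (head _ (map _ _)); apply: eq_filter => d.
by rewrite mark_translate addrAC.
Qed.

Lemma drift_translate y v u : drift (y \o translate_site v) u = drift y (u + v).
Proof.
have U K : upto (y \o translate_site v) u K = upto y (u + v) K.
  by elim: K => //= k ->; rewrite layer_translate.
rewrite /drift U; congr (upto _ _ (xget _ _)).
by apply/funext => K; apply/propext; split=> q k /q; rewrite layer_translate.
Qed.

Lemma layer_determined k u : exists s : seq site,
  determined [set` s] (fun y : coins site => layer y k u).
Proof.
exists [seq (k, u - d, i) | d <- shape k, i <- iota 0 (pexp k)] => y y' yy'.
rewrite /layer; congr (head _ (map _ _)); apply: eq_in_filter => d sd.
congr (_ && _); apply: eq_in_all => i ip; apply: yy' => /=.
exact: (allpairs_f (fun d i => (k, u - d, i))).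
Qed.

Lemma measurable_layer k u (B : set Z2) :
  measurable [set y : coins site | B (layer y k u)].
Proof.
have [s sd] := layer_determined k u; exact: (measurable_determined B sd).
Qed.

Lemma measurable_upto u K (B : set Z2) :
  measurable [set y : coins site | B (upto y u K)].
Proof.
elim: K B => [|k IH] B.
  have [B0|B0] := pselect (B 0).
    rewrite (_ : mkset _ = setT); first exact: measurableT.
    by apply/seteqP; split.
  rewrite (_ : mkset _ = set0); first exact: measurable0.
  by apply/seteqP; split.
rewrite (_ : mkset _ = [set y | (B `&` [set d | d != 0]) (layer y k u)] `|`
   ([set y | [set 0] (layer y k u)] `&` [set y | B (upto y u k)])).
  by apply: measurableU; [|apply: measurableI => //]; exact: measurable_layer.
apply/seteqP; split=> y /=.
  by case: ifPn => [l0 Bl|/negPn/eqP l0 Bu]; [left|right].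
by case=> [[Bl ->]//|[-> ]]; rewrite eqxx.
Qed.

Lemma measurable_quiet u K : measurable [set y | quiet y u K].
Proof.
rewrite (_ : mkset _ = \bigcap_(k in [set k | (K <= k)%N])
    [set y : coins site | [set 0] (layer y k u)]).
  apply: bigcap_measurable; first by exists K => /=.
  by move=> k _; exact: measurable_layer.
by apply/seteqP; split=> y q k; exact: q.
Qed.

Lemma measurable_drift u :
  measurable_fun setT ((fun y => drift y u) : coins site -> Z2).
Proof.
move=> _ B _; rewrite setTI.
pose N := ~` \bigcup_K [set y | quiet y u K].
have mN : measurable N.
  by apply/measurableC/bigcupT_measurable => K; exact: measurable_quiet.
rewrite (_ : _ @^-1` _ = (N `&` [set _ | B 0]) `|`
   \bigcup_K ([set y | quiet y u K] `&` [set y | B (upto y u K)])).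
  apply: measurableU.
    apply: measurableI => //; have [B0|B0] := pselect (B 0).
      by rewrite (_ : mkset _ = setT) //; apply/seteqP; split.
    by rewrite (_ : mkset _ = set0) //; apply/seteqP; split.
  apply: bigcupT_measurable => K; apply: measurableI; first exact: measurable_quiet.
  exact: measurable_upto.
apply/seteqP; split=> y /=.
  have [[K q]|nq] := pselect (exists K, quiet y u K).
    by rewrite (drift_quiet q) => BK; right; exists K.
  have dr0 : drift y u = 0.
    rewrite /drift xgetPN // => K q; by apply: nq; exists K.
  rewrite dr0 => B0; left; split=> //; move=> [K _ q]; by apply: nq; exists K.
case=> [[nq B0]|[K _ [q]]]; last by rewrite (drift_quiet q).
have -> // : drift y u = 0.
by rewrite /drift xgetPN // => K q; apply: nq; exists K.
Qed.

Section field.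
Variables (R : realType) (m : nat) (P : probability (coins site) R).
Hypothesis fairP : fair P.

Definition omega_fun (u : Z2) (y : coins site) : S2 R := drift_law R m (drift y u).

Lemma measurable_omega u : measurable_fun setT (omega_fun u).
Proof.
move=> _ B _; have := @measurable_drift u measurableT (drift_law R m @^-1` B).
by apply.
Qed.

Definition omega (u : Z2) : {RV P >-> S2 R} := mfun_Sub (mem_set (measurable_omega u)).

Lemma omega_translate y v u : omega u (y \o translate_site v) = omega (u + v) y.
Proof. by rewrite /= /omega_fun drift_translate. Qed.

Lemma omega_perturbative eps : 2 * delta R m <= eps -> perturbative omega eps.
Proof.
move=> de u e; rewrite -[RHS](probability_setT P); congr (P _).
apply/seteqP; split=> y //= _; rewrite in_itv /=.
have /andP[] := drift_weight_bounds R m (drift y u) e.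
by move: (drift_weight _ _ _ _) => z h1 h2; apply/andP; split; lra.
Qed.

Lemma omega_stationary : stationary omega.
Proof.
move=> v A mA; pose g (y : coins site) : env_space R := fun u => omega u y.
have mg : measurable_fun setT g.
  by apply: measurable_to_product => u; exact: measurable_omega.
have mgA : measurable (g @^-1` A) by rewrite -[X in measurable X]setTI; exact: mg.
rewrite /pushforward -[RHS](fair_reindex fairP (@translate_site_inj v) mgA).
have gE y : (fun u => omega (u + v) y) = g (y \o translate_site v).
  by apply/funext => u; rewrite /g omega_translate.
by congr (P _); apply/seteqP; split=> y /=; rewrite -gE.
Qed.

Lemma measurable_agrees (B : set Z2) (f : Z2 -> S2 R) :
  measurable (agrees omega B f).
Proof.
rewrite (_ : agrees _ _ _ = ~` \bigcup_(u in [set: Z2])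
   [set y | B u /\ omega u y <> f u]).
  apply/measurableC/countable_bigcupT_measurable; first exact: countableP.
  move=> u; have [Bu|nBu] := pselect (B u); last first.
    rewrite (_ : mkset _ = set0); first exact: measurable0.
    by apply/seteqP; split=> // y [].
  have := @measurable_drift u measurableT (drift_law R m @^-1` (~` [set f u])) I.
  rewrite setTI; congr measurable; apply/seteqP; split=> y /=; last by case.
  by move=> h; split.
apply/seteqP; split=> y /=.
  by move=> h [u _ [Bu]]; apply; exact: h.
by move=> h u Bu; apply: contrapT => ne; apply: h; exists u.
Qed.

(** Translation by [v *+ n] moves every coin away from any given one. *)
Lemma omega_mixing : mixing omega.
Proof.
split.
  move=> u; have sub : range (omega u) `<=` drift_law R m @` [set: Z2].
    by move=> _ [y _ <-]; exists (drift y u).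
  apply: sub_countable (subset_card_le sub) _.
  exact: sub_countable (card_image_le _ _) (countableP _).
move=> v a b v0 _ _ f1 f2 E1 E2.
pose E := agrees omega (box a b) f2.
have E2E n : E2 n = (fun y : coins site => (y \o translate_site (v *+ n) : coins site)) @^-1` E.
  apply/seteqP; split=> y /=.
    move=> h u Bu; rewrite omega_translate h; last by exists u.
    by rewrite /theta addrK.
  by move=> h _ [u Bu <-]; rewrite -omega_translate h // /theta addrK.
under eq_fun do rewrite E2E.
apply: (fair_mixing fairP (f := fun n => translate_site (v *+ n))).
- by move=> n; exact: translate_site_inj.
- move=> [[k z] i] [[k' z'] i'].
  have [[N HN]|none] := pselect (exists N, z + v *+ N = z').
    exists N.+1 => // n /= Nn /(congr1 (fun s : site => s.1.2)) /=.
    rewrite -HN => /addrI /eqP; apply/negP; rewrite -subr_eq0 -mulrnBr ?(ltnW Nn) //.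
    have : (0 < n - N)%N by rewrite subn_gt0.
    by move=> q0; apply: contra v0 => /eqP /(mulrn_Z2_eq0 q0) ->.
  by apply: nearW => n /(congr1 (fun s : site => s.1.2)) zn; apply: none; exists n.
- exact: measurable_agrees.
- exact: measurable_agrees.
Qed.

End field.
End environment.

(** * Probability of the good layouts *)

Definition zrange (a : int) (n : nat) : seq int := [seq a + i%:Z | i <- iota 0 n].

Lemma mem_zrange a n x : (x \in zrange a n) = (a <= x < a + n%:Z).
Proof.
apply/mapP/idP => [[i]|h]; first by rewrite mem_iota => /andP[_ ?] ->; lia.
by exists (absz (x - a)); [rewrite mem_iota; lia|lia].
Qed.

Lemma zrange_uniq a n : uniq (zrange a n).
Proof. by rewrite map_inj_uniq ?iota_uniq // => i j /addrI []. Qed.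

Definition grid k (a : int) (na : nat) (t : int) (nt : nat) : seq Z2 :=
  [seq place k x y | x <- zrange a na, y <- zrange t nt].

Lemma mem_grid k a na t nt z : (z \in grid k a na t nt) =
  (a <= along k z < a + na%:Z) && (t <= trans k z < t + nt%:Z).
Proof.
rewrite -!mem_zrange; apply/allpairsP/andP => [[[x y] /= [xa yt ->]]|[az tz]].
  by rewrite along_place trans_place.
exists (along k z, trans k z); split=> //=.
by apply: (place_eq (k := k)); rewrite ?along_place ?trans_place.
Qed.

Lemma size_grid k a na t nt : size (grid k a na t nt) = (na * nt)%N.
Proof. by rewrite size_allpairs !size_map !size_iota. Qed.

Lemma grid_uniq k a na t nt : uniq (grid k a na t nt).
Proof.
apply: allpairs_uniq; rewrite ?zrange_uniq // => -[x y] [x' y'] _ _ /= E.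
have := congr1 (along k) E; have := congr1 (trans k) E.
by rewrite !along_place !trans_place => -> ->.
Qed.

Section marks.
Variables (R : realType) (P : probability (coins site) R).
Hypothesis fairP : fair P.
Variable pexp : nat -> nat.

Definition density k : R := (2^-1) ^+ pexp k.

Definition marked k z : set (coins site) := [set y | mark pexp y k z].

Let cells k z : seq site := [seq (k, z, i) | i <- iota 0 (pexp k)].

Let cells_uniq k z : uniq (cells k z).
Proof. by rewrite map_inj_uniq ?iota_uniq // => i j []. Qed.

Let size_cells k z : size (cells k z) = pexp k.
Proof. by rewrite size_map size_iota. Qed.

Let markedE k z : marked k z = [set y : coins site | {in cells k z, forall s, y s}].
Proof.
apply/seteqP; split=> y /=.
  by move=> /allP my _ /mapP[i ip ->]; exact: my.
by move=> my; apply/allP => i ip; apply: my; apply: map_f.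
Qed.

Lemma measurable_marked k z : measurable (marked k z).
Proof. by rewrite markedE; exact: (measurable_cylinder _ (fun=> true)). Qed.

Lemma pr_marked k z : pr P (marked k z) = density k.
Proof. by rewrite /pr markedE (fairP (cells_uniq k z)) size_cells. Qed.

Lemma pr_marked2 k z z' : z != z' ->
  pr P (marked k z `&` marked k z') = density k ^+ 2.
Proof.
move=> zz'; rewrite !markedE /pr.
have -> : [set y : coins site | {in cells k z, forall s, y s}] `&`
    [set y | {in cells k z', forall s, y s}] =
    [set y : coins site | {in cells k z ++ cells k z', forall s, y s}].
  apply/seteqP; split=> y /=.
    by move=> [H1 H2] s; rewrite mem_cat => /orP[/H1|/H2].
  by move=> H; split=> s sc; apply: H; rewrite mem_cat sc ?orbT.
rewrite (fairP (s := cells k z ++ cells k z')).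
  by rewrite size_cat !size_cells /= /density -exprM muln2 addnn.
rewrite cat_uniq !cells_uniq andbT /=; apply/hasPn => s /mapP[i _ ->].
by apply/mapP => -[j _ [] zE]; rewrite zE eqxx in zz'.
Qed.

Lemma determined_marked k z :
  determined [set s : site | s.1 = (k, z)] (marked k z).
Proof.
move=> y y' yy'; rewrite /marked /mkset /mark; congr is_true.
by apply: eq_all => i; apply: yy'.
Qed.

Lemma density_le1 k : 0 <= density k <= 1.
Proof. by rewrite exprn_ge0 ?exprn_ile1 ?invr_ge0 ?invf_le1 //; lra. Qed.

(** None of the sites of [l] carries a mark. *)
Definition no_mark k (l : seq Z2) : set (coins site) :=
  [set y | {in l, forall z, ~ marked k z y}].

Lemma measurable_clear k l : measurable (no_mark k l).
Proof.
elim: l => [|z l IH].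
  by rewrite (_ : no_mark _ _ = setT) //; apply/seteqP; split.
rewrite (_ : no_mark _ _ = ~` marked k z `&` no_mark k l).
  by apply: measurableI => //; apply: measurableC; exact: measurable_marked.
apply/seteqP; split=> y /=.
  by move=> h; split=> [|z' lz']; apply: h; rewrite inE ?eqxx ?lz' ?orbT.
by move=> [h1 h2] z'; rewrite inE => /orP[/eqP->|/h2].
Qed.

Lemma determined_clear k l :
  determined [set s : site | s.1.1 = k /\ s.1.2 \in l] (no_mark k l).
Proof.
move=> y y' yy'; apply/propext; split=> h z lz.
  rewrite (_ : marked k z y' = marked k z y); first exact: h.
  by apply: determined_marked => s /= sE; apply/esym/yy'; rewrite /= sE.
rewrite (_ : marked k z y = marked k z y'); first exact: h.
by apply: determined_marked => s /= sE; apply/yy'; rewrite /= sE.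
Qed.

Lemma pr_clear k l : uniq l -> pr P (no_mark k l) = (1 - density k) ^+ size l.
Proof.
elim: l => [|z l IH] /=.
  by rewrite expr0 -(prT P) (_ : no_mark _ _ = setT) //; apply/seteqP; split.
move=> /andP[zl ul]; rewrite (_ : no_mark _ _ = ~` marked k z `&` no_mark k l).
  have mm := measurableC (measurable_marked k z); have mc := measurable_clear k l.
  apply: EFin_inj; rewrite -prE; last exact: measurableI.
  rewrite (fair_independent fairP (D := [set s : site | s.1 = (k, z)]) mm mc).
  - by rewrite !prE // pr_setC ?pr_marked ?IH // ?exprS //; exact: measurable_marked.
  - by move=> y y' yy'; rewrite /setC /mkset (determined_marked yy').
  move=> y y' yy'; apply: determined_clear => s [sk sl]; apply: yy' => /= sE.
  by rewrite sE /= (negbTE zl) in sl.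
apply/seteqP; split=> y /=.
  by move=> h; split=> [|z' lz']; apply: h; rewrite inE ?eqxx ?lz' ?orbT.
by move=> [h1 h2] z'; rewrite inE => /orP[/eqP->|/h2].
Qed.

(** This is the inequality [(1 - p) ^ n * (n * p) <= 1], weaker than an
    exponential bound but sufficient for scales that grow this fast. *)
Lemma pr_clear_le k l : uniq l -> (0 < size l)%N ->
  pr P (no_mark k l) * ((size l)%:R * density k) <= 1.
Proof.
move=> ul sl; rewrite (pr_clear k ul).
have := density_le1 k; move: (density k) => p /andP[p0 p1].
elim: (size l) => [|n IH]; first by rewrite mul0r mulr0.
have IH' : (1 - p) ^+ n * (n%:R * p) <= 1 by [].
have q0 : 0 <= (1 - p) ^+ n by rewrite exprn_ge0 // subr_ge0.
have q1 : (1 - p) ^+ n <= 1 by rewrite exprn_ile1 ?subr_ge0 // gerBl.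
rewrite exprS -natr1; move: q0 q1 IH'; move: ((1 - p) ^+ n) => q q0 q1 IH'.
set N := n%:R in IH' *; have N0 : 0 <= N by rewrite ler0n.
have : (1 - p) * (q * (N * p)) <= (1 - p) * 1 by apply: ler_wpM2l => //; lra.
have : p * (1 - p) * q <= p * 1.
  rewrite -mulrA; apply: ler_wpM2l => //.
  by rewrite -[leRHS]mulr1; apply: ler_pM => //; lra.
by lra.
Qed.

Definition some_mark k (l : seq Z2) : set (coins site) :=
  \big[setU/set0]_(z <- l) marked k z.

Lemma pr_some_le k l : pr P (some_mark k l) <= (size l)%:R * density k.
Proof.
apply: le_trans (pr_bigsetU_le P l (measurable_marked k)) _.
under eq_bigr do rewrite pr_marked.
by rewrite big_const_seq count_predT iter_addr addr0 mulr_natl.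
Qed.

End marks.

Section scales.
Variables (R : realType) (m : nat).

(** The scales are powers of 2 with exponents in [rank k]. The density of roads
    of level [k] is [2 ^ (- rank k ^ 2 - rank k)], which is small compared to
    the inverse of [radius k] and large compared to the inverse of
    [radius k.+1]. The offset [m + 10] makes every error small from level 0 on,
    for a drift of order [2 ^ - (m+3)]. *)
Definition rank (k : nat) : nat := (k + (m + 10))%N.
Definition radius (k : nat) : nat := (2 ^ (rank k ^ 2))%N.
Definition width (k : nat) : nat := (2 ^ (rank k + m + 6))%N.
Definition reach (k : nat) : nat := (radius k.+2 ^ 2)%N.
Definition rarity (k : nat) : nat := (rank k ^ 2 + rank k + 2 * rank k.+2 ^ 2)%N.

Lemma rankS k : rank k.+1 = (rank k).+1.
Proof. by []. Qed.

Lemma rank_ge10 k : (m + 10 <= rank k)%N.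
Proof. exact: leq_addl. Qed.

Lemma sqrS n : (n.+1 ^ 2 = n ^ 2 + n.*2.+1)%N.
Proof. by rewrite !expnS !expn0; lia. Qed.

Lemma radiusS k : radius k.+1 = (2 * (2 ^ rank k) ^ 2 * radius k)%N.
Proof.
by rewrite /radius rankS sqrS -expnM -expnS -expnD; congr (2 ^ _)%N; lia.
Qed.

(** Roads are much narrower than the distance between them. *)
Lemma width_le k : (128 * width k * 2 ^ rank k <= radius k)%N.
Proof.
rewrite (_ : 128 = 2 ^ 7)%N // -!expnD leq_exp2l //.
by have := rank_ge10 k; move: (rank k) => n h; rewrite expnS expn1; nia.
Qed.

Lemma quad_le_exp n : (0 < n)%N -> (n ^ 2 + 5 * n + 10 <= 8 * 2 ^ n)%N.
Proof.
case: n => // n _; elim: n => [//|n IH]; rewrite sqrS (expnS 2 n.+1); lia.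
Qed.

(** By the inequality of Bernoulli, [2 ^ (m+3)] factors [base] give at least 2. *)
Lemma base_pow j : 2 ^+ j <= base R m ^ ((2 ^ m.+3 * j)%N)%:Z.
Proof.
rewrite -exprnP exprM; apply: lerXn2r; rewrite ?nnegrE //.
  by rewrite exprn_ge0 // ltW // base_gt0.
have d0 := delta_gt0 R m.
have bern n : 1 + n%:R * delta R m <= base R m ^+ n.
  elim: n => [|n IH]; first by rewrite mul0r addr0 expr0.
  rewrite exprS; have b0 := base_gt0 R m.
  apply: le_trans (ler_wpM2l (ltW b0) IH).
  rewrite /base -natr1; have n0 : 0 <= n%:R :> R by rewrite ler0n.
  have := mulr_ge0 n0 (mulr_ge0 (ltW d0) (ltW d0)); lra.
apply: le_trans (bern _); rewrite /delta natrX divff; first by lra.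
by rewrite expf_neq0.
Qed.

Lemma scalesP : scales R m radius width.
Proof.
split=> k.
- by rewrite expn_gt0.
- by rewrite leq_exp2l // rankS; lia.
- have := width_le k; have : (0 < 2 ^ rank k)%N by rewrite expn_gt0.
  by move: (width k) (2 ^ rank k)%N (radius k) => a b c; nia.
- rewrite radiusS; have : (2 <= 2 ^ rank k)%N.
    by rewrite -{1}[2%N]expn1 leq_exp2l //; have := rank_ge10 k; lia.
  move: (2 ^ rank k)%N (radius k) => a b a2; have aa := leq_mul a2 a2.
  by rewrite leq_mul2r expnS expn1; lia.
have -> : width k = (2 ^ m.+3 * 2 ^ (rank k).+3)%N.
  by rewrite -expnD; congr (2 ^ _)%N; lia.
apply: le_trans (base_pow _).
rewrite natrX -exprD; apply: ler_weXn2l; first by lra.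
have n0 : (0 < rank k)%N by have := rank_ge10 k; lia.
have kn : (k <= rank k)%N by rewrite /rank; lia.
have -> : (2 ^ (rank k).+3 = 8 * 2 ^ rank k)%N by rewrite !expnS; lia.
have := quad_le_exp n0; rewrite !rankS (sqrS (rank k).+1) sqrS.
by move: (rank k ^ 2)%N (2 ^ rank k)%N (rank k) kn => n2 e n kn; lia.
Qed.

End scales.

Section bad_levels.
Variables (R : realType) (P : probability (coins site) R) (m : nat).
Hypothesis fairP : fair P.

Local Notation r := (radius m).
Local Notation w := (width m).
Local Notation M := (reach m).
Local Notation p := (density R (rarity m)).
Local Notation mark := (mark (rarity m)).
Local Notation marked := (marked (rarity m)).

Lemma M_ge k : (4 * r k.+2 + 4 <= M k)%N.
Proof.
have : (8 <= r k.+2)%N.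
  rewrite (_ : 8 = 2 ^ 3)%N // leq_exp2l //; have := rank_ge10 m k.+2.
  by move: (rank m k.+2) => n h; rewrite expnS expn1; nia.
by rewrite /reach; move: (r k.+2) => a h; rewrite expnS expn1; nia.
Qed.

Definition end_sites k : seq Z2 :=
  grid k (- (r k.+2)%:Z) (2 * r k.+2 + 1) (- (2 * r k.+2)%:Z) (4 * r k.+2 + 1) ++
  grid k (- (r k.+2)%:Z - (M k)%:Z) (2 * r k.+2 + 1) (- (2 * r k.+2)%:Z) (4 * r k.+2 + 1).

Definition near_sites k : seq Z2 :=
  grid k (- (M k)%:Z) (M k) (- (2 * r k)%:Z) (4 * r k + 1).

(** The second mark is listed by its coordinate along the roads and by its
    offset across the roads from the first one. *)
Definition close_pairs k : seq (Z2 * Z2) :=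
  [seq zz <- [seq (z, place k (along k q) (trans k z + trans k q))
     | z <- grid k (- (M k)%:Z) (M k) (- (2 * r k.+1)%:Z) (4 * r k.+1 + 1),
       q <- grid k (- (M k)%:Z) (M k) (- (4 * w k + 1)%:Z) (8 * w k + 3)]
   | zz.1 != zz.2].

Definition ahead_sites k : seq Z2 :=
  grid k (- (M k - r k.+2 - 1)%N%:Z) (M k - 2 * r k.+2 - 1)
    (2 * r k + 1)%:Z (r k.+1 - 2 * r k).

Definition close_marks k : set (coins site) :=
  \big[setU/set0]_(zz <- close_pairs k) (marked k zz.1 `&` marked k zz.2).

Definition bad_level k : set (coins site) :=
  some_mark (rarity m) k (end_sites k) `|` some_mark (rarity m) k (near_sites k) `|` close_marks k `|`
  no_mark (rarity m) k (ahead_sites k).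

Lemma bad_good k y : ~ bad_level k y -> good_level r w M k (mark y k).
Proof.
move=> nb.
have [n1 n2 n3 n4] : [/\ ~ some_mark (rarity m) k (end_sites k) y, ~ some_mark (rarity m) k (near_sites k) y,
    ~ close_marks k y & ~ no_mark (rarity m) k (ahead_sites k) y].
  by split=> h; apply: nb; rewrite /bad_level; [left; left; left|left; left; right|left; right|right].
have Mk := M_ge k.
split.
- move=> z mz tz az; apply: n1; rewrite /some_mark -bigcup_seq; exists z => //=.
  rewrite /end_sites mem_cat !mem_grid; move: tz az.
  by move: (along k z) (trans k z) => a t ht [ha|ha]; apply/orP; [left|right]; lia.
- move=> z mz [s1 s2]; rewrite ltNge; apply/negP => tz; apply: n2.
  rewrite /some_mark -bigcup_seq; exists z => //=; rewrite mem_grid.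
  by move: (along k z) (trans k z) s1 s2 tz => a t; lia.
- move=> z z' mz mz' [s1 s2] [s1' s2'] tz tzz.
  apply: contrapT => zz'; apply: n3; rewrite /close_marks -bigcup_seq.
  exists (z, z') => //=; rewrite mem_filter /=; apply/andP; split; first exact/eqP.
  pose q := place k (along k z') (trans k z' - trans k z).
  have -> : z' = place k (along k q) (trans k z + trans k q).
    apply: (place_eq (k := k)); rewrite /q ?along_place ?trans_place //.
    by rewrite addrC subrK.
  apply: (allpairs_f (fun z q => (z, place k (along k q) (trans k z + trans k q)))).
    by rewrite mem_grid; move: (along k z) (trans k z) s1 s2 tz => a t; lia.
  rewrite mem_grid /q along_place trans_place.
  by move: (along k z') (trans k z') (trans k z) s1' s2' tzz => a t t'; lia.
have [z lz mz] : exists2 z, z \in ahead_sites k & mark y k z.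
  apply: contrapT => H; apply: n4 => z lz mz; by apply: H; exists z.
have := scalesP R m => -[_ _ _ rg _]; have rgk := rg k.
exists z; split=> //; move: lz; rewrite mem_grid /spans.
  by move: (along k z) (trans k z) => a t; lia.
by move: (along k z) (trans k z) => a t; lia.
Qed.

Lemma measurable_some k l : measurable (some_mark (rarity m) k l).
Proof. by apply: bigsetU_measurable => z _; exact: measurable_marked. Qed.

Lemma measurable_close k : measurable (close_marks k).
Proof.
by apply: bigsetU_measurable => z _; apply: measurableI; exact: measurable_marked.
Qed.

Lemma measurable_bad k : measurable (bad_level k).
Proof.
apply: measurableU; last exact: measurable_clear.
apply: measurableU; last exact: measurable_close.
by apply: measurableU; exact: measurable_some.
Qed.

Lemma determined_bad k : determined [set s : site | s.1.1 = k] (bad_level k).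
Proof.
move=> y y' yy'.
have mE z : marked k z y = marked k z y'.
  by apply: determined_marked => s /= sE; apply: yy'; rewrite /= sE.
have sE l : some_mark (rarity m) k l y = some_mark (rarity m) k l y'.
  rewrite /some_mark -!bigcup_seq; apply/propext.
  by split=> -[z lz mz]; exists z => //; rewrite ?mE // -mE.
have cE : close_marks k y = close_marks k y'.
  rewrite /close_marks -!bigcup_seq; apply/propext.
  by split=> -[z lz [mz mz']]; exists z => //; split; rewrite ?mE // -mE.
have kE : no_mark (rarity m) k (ahead_sites k) y = no_mark (rarity m) k (ahead_sites k) y'.
  by apply: determined_clear => s [sk _]; apply: yy'.
by rewrite /bad_level /setU /mkset !sE cE kE.
Qed.

(** With [N = 2 ^ rank k], the density [p] of the marks satisfies
    [p * reach k * radius k * N = 1], and [reach k] is the square of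
    [radius k.+2]. So the number of sites times [p] is of order at most [1 / N]
    for the ends of roads and for roads close to the origin; the number of
    close pairs times [p ^ 2] is of order [width k / radius k]; and the expected
    number of roads ahead is of order [N]. *)
Lemma pr_bad k : pr P (bad_level k) <= 16 / 2 ^+ rank m k.
Proof.
have m1 := measurable_some k (end_sites k); have m2 := measurable_some k (near_sites k).
have m3 := measurable_close k; have m4 := measurable_clear (rarity m) k (ahead_sites k).
have m12 := measurableU _ _ m1 m2; have m123 := measurableU _ _ m12 m3.
have pb : pr P (bad_level k) <= pr P (some_mark (rarity m) k (end_sites k)) +
    pr P (some_mark (rarity m) k (near_sites k)) + pr P (close_marks k) +
    pr P (no_mark (rarity m) k (ahead_sites k)).
  apply: le_trans (pr_setU P m123 m4) _; rewrite lerD2r.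
  apply: le_trans (pr_setU P m12 m3) _; rewrite lerD2r.
  exact: pr_setU.
apply: le_trans pb _.
have h1 := pr_some_le fairP (rarity m) k (end_sites k).
have h2 := pr_some_le fairP (rarity m) k (near_sites k).
have h3 : pr P (close_marks k) <= (size (close_pairs k))%:R * p k ^+ 2.
  have mc zz : measurable (marked k zz.1 `&` marked k zz.2).
    by apply: measurableI; exact: measurable_marked.
  apply: le_trans (pr_bigsetU_le P (close_pairs k) mc) _.
  rewrite big_seq (eq_bigr (fun=> p k ^+ 2)); last first.
    by move=> [z z']; rewrite mem_filter => /andP[zz' _]; exact: (pr_marked2 fairP).
  rewrite -big_seq big_const_seq count_predT iter_addr addr0 mulr_natl.
  exact: lexx.
have szn : size (near_sites k) = (M k * (4 * r k + 1))%N by rewrite size_grid.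
have sza : size (ahead_sites k) = ((M k - 2 * r k.+2 - 1) * (r k.+1 - 2 * r k))%N.
  by rewrite size_grid.
have [w0 _ _ rg _] := scalesP R m.
have Mk := M_ge k; have rgk := rg k; have wk := width_le m k; have wk0 := w0 k.
have N0 : (0 < 2 ^ rank m k)%N by rewrite expn_gt0.
have sa : (M k * r k.+1 <= 4 * size (ahead_sites k))%N.
  rewrite sza (_ : 4 = 2 * 2)%N // mulnACA; apply: leq_mul; lia.
have rk : (128 <= r k)%N.
  have := leq_mul wk0 N0; move: wk; rewrite -mulnA.
  by move: (w k * _)%N (r k) => a b; lia.
have sa0 : (0 < size (ahead_sites k))%N.
  have : (0 < M k * r k.+1)%N by rewrite muln_gt0; lia.
  by move: sa; move: (size _) (_ * _)%N => a b; lia.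
have h4 := pr_clear_le fairP (rarity m) k (grid_uniq k _ _ _ _ : uniq (ahead_sites k)) sa0.
have se : (size (end_sites k) <= 30 * M k)%N.
  rewrite size_cat !size_grid /reach; have : (0 < r k.+2)%N by rewrite expn_gt0.
  by move: (r k.+2) => a; rewrite expnS expn1; nia.
have sn : (size (near_sites k) <= 5 * (M k * r k))%N.
  by rewrite szn mulnCA leq_mul2l; apply/orP; right; lia.
have sc : (size (close_pairs k) <= 55 * (M k * M k * (r k.+1 * w k)))%N.
  rewrite size_filter (leq_trans (count_size _ _)) // size_allpairs !size_grid.
  rewrite (_ : M k * (4 * r k.+1 + 1) * (M k * (8 * w k + 3)) =
     M k * M k * ((4 * r k.+1 + 1) * (8 * w k + 3)))%N; last by rewrite mulnACA.
  rewrite (_ : 55 * (M k * M k * (r k.+1 * w k)) =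
     M k * M k * ((5 * r k.+1) * (11 * w k)))%N; last by lia.
  by rewrite leq_mul2l; apply/orP; right; apply: leq_mul; lia.
pose N : R := 2 ^+ rank m k.
have rS : (r k.+1)%:R = 2 * N ^+ 2 * (r k)%:R :> R.
  by rewrite radiusS !natrM !natrX.
have pE : p k * (M k)%:R * (r k)%:R * N = 1.
  have hn : (M k * r k * 2 ^ rank m k = 2 ^ rarity m k)%N.
    by rewrite /reach /radius -expnM -!expnD /rarity; congr (2 ^ _)%N; lia.
  rewrite -(mulrA (p k)) -(mulrA (p k)) -natrM /N -natrX -natrM hn natrX /density.
  by rewrite exprVn mulVf // expf_neq0.
have [p0 p1] := andP (density_le1 R (rarity m) k).
have Nge : 0 < N by rewrite exprn_gt0.
have q4 := pr_ge0 P (no_mark (rarity m) k (ahead_sites k)).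
move: h1 h2 h3 h4 q4; rewrite -/N; move: (pr P _) (pr P _) (pr P _) (pr P _) => x4 x3 x2 x1.
move=> h1 h2 h3 h4 q4.
have {}se : (size (end_sites k))%:R <= 30 * (M k)%:R :> R by rewrite -natrM ler_nat.
have {}sn : (size (near_sites k))%:R <= 5 * ((M k)%:R * (r k)%:R) :> R.
  by rewrite -!natrM ler_nat.
have {}sc : (size (close_pairs k))%:R <=
    55 * ((M k)%:R * (M k)%:R * ((r k.+1)%:R * (w k)%:R)) :> R.
  by rewrite -!natrM ler_nat.
have {}sa : (M k)%:R * (r k.+1)%:R <= 4 * (size (ahead_sites k))%:R :> R.
  by rewrite -!natrM ler_nat.
have {}wk : 128 * (w k)%:R * N <= (r k)%:R by rewrite /N -natrX -!natrM ler_nat.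
have {}rk : 128 <= (r k)%:R :> R by rewrite (ler_nat R 128).
rewrite rS in sc sa.
move: (size (end_sites k))%:R (size (near_sites k))%:R (size (close_pairs k))%:R
  (size (ahead_sites k))%:R (p k) (M k)%:R (r k)%:R (w k)%:R (ler0n R (w k))
  se sn sc sa wk rk pE p0 h1 h2 h3 h4 (ler0n R (M k)) => s1 s2 s3 s4 q MM rr ww ww0.
clear - Nge q4 ww0; move=> se sn sc sa wk rk pE p0 h1 h2 h3 h4 M0.
have r0 : 0 < rr by lra.
have qM : q * MM = N^-1 * rr^-1.
  rewrite -invfM; apply: (mulIf (lt0r_neq0 (mulr_gt0 Nge r0))).
  by rewrite mulVf ?(lt0r_neq0 (mulr_gt0 Nge r0)) // -pE; ring.
have iN : 0 < N^-1 by rewrite invr_gt0.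
have ir : 0 < rr^-1 by rewrite invr_gt0.
have NV : N * N^-1 = 1 by rewrite divff // gt_eqF.
have rV : rr * rr^-1 = 1 by rewrite divff // gt_eqF.
have e1 : x1 <= N^-1.
  apply: (le_trans h1); apply: (le_trans (ler_wpM2r p0 se)).
  rewrite -mulrA (mulrC MM) qM mulrCA ger_pMr //.
  rewrite -rV; apply: ler_wpM2r; [exact: ltW|lra].
have e2 : x2 <= 5 * N^-1.
  apply: (le_trans h2); apply: (le_trans (ler_wpM2r p0 sn)).
  rewrite (_ : 5 * (MM * rr) * q = 5 * (q * MM) * rr); last by ring.
  rewrite qM (_ : 5 * (N^-1 * rr^-1) * rr = 5 * N^-1 * (rr * rr^-1)); last by ring.
  by rewrite rV mulr1.
have e3 : x3 <= N^-1.
  apply: (le_trans h3); apply: (le_trans (ler_wpM2r (exprn_ge0 2 p0) sc)).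
  rewrite (_ : 55 * (MM * MM * (2 * N ^+ 2 * rr * ww)) * q ^+ 2 =
     110 * ww * N ^+ 2 * rr * (q * MM) ^+ 2); last by ring.
  rewrite qM (_ : 110 * ww * N ^+ 2 * rr * (N^-1 * rr^-1) ^+ 2 =
     110 * ww * (N * N^-1) ^+ 2 * (rr * rr^-1) * rr^-1); last by ring.
  rewrite NV rV expr1n !mulr1 ler_pdivrMr // (mulrC N^-1) ler_pdivlMr //.
  have := mulr_ge0 ww0 (ltW Nge); lra.
have e4 : x4 <= 2 * N^-1.
  rewrite ler_pdivlMr //.
  have : MM * (2 * N ^+ 2 * rr) * q <= 4 * s4 * q by apply: ler_wpM2r.
  rewrite (_ : MM * (2 * N ^+ 2 * rr) * q = 2 * N * (q * MM * rr * N)); last by ring.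
  rewrite pE mulr1 => hs; have := ler_wpM2l q4 hs; lra.
by lra.
Qed.

End bad_levels.

(** * The two directions *)

Section good_set.
Variables (R : realType) (P : probability (coins site) R) (m : nat).
Hypothesis fairP : fair P.

Local Notation r := (radius m).
Local Notation w := (width m).
Local Notation M := (reach m).
Local Notation mark := (mark (rarity m)).

Definition others : seq Z2 :=
  [seq z <- grid 0 (- (r 2 + M 0)%:Z) (2 * (r 2 + M 0) + 1)
     (- (2 * r 2)%:Z) (4 * r 2 + 1) | z != start r].

(** Level 0 has a mark at [start] and no other mark near the origin. *)
Definition lone_start : set (coins site) :=
  marked (rarity m) 0 (start r) `&` no_mark (rarity m) 0 others.

Lemma begin_good y : lone_start y -> good_start r M (mark y 0%N).
Proof.
move=> [ms cl]; split=> // z mz tz az; apply: contrapT => /eqP zs.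
apply: (cl z) => //; rewrite mem_filter zs mem_grid /along /trans /=.
by move: tz az; move: (z.1) (z.2) => a b; lia.
Qed.

Lemma measurable_begin : measurable lone_start.
Proof. by apply: measurableI; [exact: measurable_marked|exact: measurable_clear]. Qed.

Lemma pr_begin_gt0 : 0 < pr P lone_start.
Proof.
have mm := measurable_marked (rarity m) 0 (start r).
have mc := measurable_clear (rarity m) 0 others.
rewrite -lte_fin -prE; last exact: measurable_begin.
rewrite (fair_independent fairP (D := [set s : site | s.1 = (0%N, start r)]) mm mc);
    last 2 first.
- exact: determined_marked.
- move=> y y' yy'; apply: determined_clear => s [s0]; rewrite mem_filter => /andP[sn _].
  by apply: yy' => /= sE; rewrite sE eqxx in sn.
rewrite !prE // -EFinM lte_fin (pr_marked fairP) (pr_clear fairP) ?filter_uniq ?grid_uniq //.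
have rp : (0 < rarity m 0)%N by rewrite /rarity /rank; lia.
rewrite mulr_gt0 ?exprn_gt0 ?invr_gt0 // subr_gt0 /density.
by rewrite exprn_ilt1 ?invr_ge0 // ?invf_lt1 ?ltr1n // -lt0n.
Qed.

(** The events of level 0 and those of higher levels concern disjoint sets of
    coins; the former have positive probability and the latter fail with
    probability at most 1/2. *)
Lemma good_set : exists G : set (coins site), [/\ measurable G, 0 < pr P G &
  forall y, G y -> good_start r M (mark y 0%N) /\
    forall k, good_level r w M k.+1 (mark y k.+1)].
Proof.
pose U := \bigcup_k bad_level m k.+1.
have mU : measurable U by apply: bigcupT_measurable => k; exact: measurable_bad.
have prU : pr P U <= 2^-1.
  apply: (pr_bigcup_le (b := fun k => 4^-1 / 2 ^+ k)).
  - by move=> k; exact: measurable_bad.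
  - (* rank m k.+1 is k + m + 11, so the bound is 2 ^ -7 / 2 ^ (k + m) *)
    move=> k; apply: le_trans (pr_bad m fairP k.+1) _.
    rewrite (_ : rank m k.+1 = k + (m + 5 + 6))%N; last by rewrite /rank; lia.
    rewrite exprD invfM mulrCA mulrC ler_wpM2r ?invr_ge0 ?exprn_ge0 //.
    rewrite (exprD _ (m + 5)) invfM.
    have h : (2 ^+ (m + 5))^-1 <= 1 :> R.
      by rewrite invf_le1 ?exprn_gt0 // exprn_ege1 // ler1n.
    rewrite (_ : 2 ^+ 6 = 64 :> R); last by rewrite !exprS expr0; lra.
    by lra.
  move=> n; have -> : \sum_(i < n) 4^-1 / 2 ^+ i = 2^-1 * (1 - 2^-1 ^+ n) :> R.
    elim: n => [|n IH]; first by rewrite big_ord0 expr0 subrr mulr0.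
    rewrite big_ord_recr /= IH exprS -exprVn; move: (2^-1 ^+ n) => q; lra.
  have : 0 <= 2^-1 ^+ n :> R by rewrite exprn_ge0 // invr_ge0.
  by lra.
exists (lone_start `&` ~` U); split.
- by apply: measurableI; [exact: measurable_begin|exact: measurableC].
- have mb := measurable_begin; have mn := measurableC mU.
  rewrite -lte_fin -prE; last exact: measurableI.
  rewrite (fair_independent fairP (D := [set s : site | s.1.1 = 0%N]) mb mn).
  + rewrite !prE // -EFinM lte_fin mulr_gt0 ?pr_begin_gt0 // pr_setC //; lra.
  + move=> y y' yy'; rewrite /lone_start /setI /mkset.
    rewrite (@determined_marked _ 0 _ y y'); last first.
      by move=> s /= sE; apply: yy'; rewrite /= sE.
    by rewrite (@determined_clear _ 0 _ y y') // => s [s0 _]; exact: yy'.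
  move=> y y' yy'; rewrite /setC /mkset; congr (~ _); apply/propext.
  have bE k : bad_level m k.+1 y = bad_level m k.+1 y'.
    by apply: determined_bad => s /= sk; apply: yy' => /=; rewrite sk.
  by split=> -[k _ bk]; exists k => //; rewrite ?bE // -bE.
move=> y [beg nU]; split; first exact: begin_good.
by move=> k; apply: (bad_good R) => bk; apply: nU; exists k.
Qed.

End good_set.

Section both_directions.
Variables (R : realType) (m : nat).
Local Notation r := (radius m).
Local Notation w := (width m).
Local Notation M := (reach m).
Local Notation drift := (drift (rarity m) w M).

Definition flip_site (s : site) : site := (s.1.1, flip w M s.1.1 s.1.2, s.2).

Lemma flip_site_inj : injective flip_site.
Proof.
apply: (can_inj (g := flip_site)) => -[[k z] i].
by rewrite /flip_site /= flipK.
Qed.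

(** Reindexing the coins so that the new layout of roads is the reflection of
    the original one. *)
Definition turn (b : bool) (y : coins site) : coins site :=
  if b then y \o flip_site else y.

Lemma good_road_turn b (y : coins site) :
  good_start r M (mark (rarity m) (turn b y) 0%N) ->
  (forall k, good_level r w M k.+1 (mark (rarity m) (turn b y) k.+1)) ->
  exists c, road r w c (fun u => reflect b (drift y (reflect b u))).
Proof.
have [w0 _ wr rg _] := scalesP R m.
have Mb : (3 * r 2 < M 0)%N by have := M_ge m 0; lia.
move=> gs gl; apply: (good_road w0 wr rg Mb _ gs gl).
case: b {gs gl} => /=; last exact: drift_obeys.
exact: obeys_flip w0 (@drift_obeys (rarity m) w M y).
Qed.

End both_directions.

Lemma integral_ge_on d (T : measurableType d) (R : realType) (P : probability T R)
    (f : T -> \bar R) (G : set T) (c : R) :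
  measurable_fun setT f -> (forall x, 0 <= f x)%E -> measurable G -> 0 <= c ->
  (forall x, G x -> c%:E <= f x)%E -> (c%:E * P G <= \int[P]_x f x)%E.
Proof.
move=> mf f0 mG c0 Gc.
apply: (@le_trans _ _ (\int[P]_(x in G) f x)%E); last first.
  exact: ge0_subset_integral.
rewrite -(integral_cst P mG c%:E); apply: ge0_le_integral => //.
exact: measurable_funTS.
Qed.

Theorem theorem1p0p1 (R : realType) (eps : R) (eps_gt0 : 0 < eps) :
  exists (d : measure_display) (Omega : measurableType d)
    (P : probability Omega R) (omega : Z2 -> {RV P >-> S2 R}),
    [/\ perturbative omega eps, stationary omega & mixing omega] /\
    exists2 Q : R.-pker Omega ~> path_space,
      quenched_law omega Q &
      (0 < annealed P Q (to_pinfty R))%E /\ (0 < annealed P Q (to_ninfty R))%E.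
Proof.
have [m me] : exists m, 2 * delta R m <= eps.
  exists (Num.truncn eps^-1).
  set n := Num.truncn _.
  have h1 : eps^-1 < n.+1%:R by exact: truncnS_gt.
  have h2 : n.+1%:R <= 2 ^+ n :> R by rewrite -natrX ler_nat ltn_expl.
  have h3 : (2 ^+ n)^-1 <= eps.
    by rewrite -[eps]invrK lef_pV2 ?posrE ?invr_gt0 ?exprn_gt0 // (le_trans (ltW h1)).
  have : 2 * delta R n <= (2 ^+ n)^-1.
    rewrite /delta -[n.+3]addn3 exprD invfM.
    have : 0 < (2 ^+ n)^-1 :> R by rewrite invr_gt0 exprn_gt0.
    rewrite (_ : 2 ^+ 3 = 8 :> R); last by rewrite !exprS expr0; lra.
    lra.
  by move/le_trans; apply.
have [P fairP] := fair_coins site R.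
have [mu fair_mu] := fair_coins (nat * 'I_m.+3)%type R.
have [step stepP] := choice (fun d : Z2 =>
  function_of_fibers [ffun=> true] (etrans (sum_numerator R m d)
    (esym (etrans (card_ffun _ _) (congr2 expn card_bool (card_ord _)))))).
pose r := radius m; pose w := width m; pose M := reach m.
have mT u := measurable_drift (rarity m) w M u.
exists _, (coins site), P, (@omega (rarity m) w M R m P); split.
  split; first exact: omega_perturbative.
    exact: omega_stationary.
  exact: omega_mixing.
pose Q : R.-pker (coins site) ~> path_space := walk_kernel mu mT step.
have QE y : walk_law (fun u => drift_law R m (drift (rarity m) w M y u)) 0 (Q y).
  exact: (walk_kernel_law fair_mu (@drift_lawE R m) mT stepP y).
exists Q; first exact: QE.
have [G [mG G0 Ggood]] := good_set m fairP.
have mturn b : measurable (turn m b @^-1` G) /\ pr P (turn m b @^-1` G) = pr P G.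
  case: b => //; split; last first.
    by rewrite /pr (fair_reindex fairP (flip_site_inj (m := m))).
  rewrite -[X in measurable X]setTI.
  exact: (@measurable_reindex site site _ bool (flip_site m) measurableT G mG).
have pos b : (0 < annealed P Q (drifts (fun u => dotZ2 (reflect b u) ones)))%E.
  have [mGb prGb] := mturn b.
  have mD := measurable_drifts (fun u => dotZ2 (reflect b u) ones).
  apply: (@lt_le_trans _ _ ((2^-1)%:E * P (turn m b @^-1` G))%E).
    by rewrite (prE P mGb) prGb -EFinM lte_fin mulr_gt0.
  apply: integral_ge_on => //; first exact: measurable_kernel.
  move=> y Gy; have [gs gl] := Ggood _ Gy.
  have [c rc] := good_road_turn R gs gl.
  have := road_escape (mu := distribution mu (walk_mfun mT step y)) (scalesP R m) rc (QE y).
  by rewrite -lee_fin -prE.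
split; last by have := pos true; rewrite to_ninftyE (_ : (fun u => _) =
  (fun u => - dotZ2 u ones)) //; apply/funext => u; rewrite /dotZ2 /=; ring.
by rewrite to_pinftyE; exact: pos false.
Qed.
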